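(* Let $T>0$, $V>0$ and $\alpha_1,\alpha_2\ge0$ with $\alpha_1+\alpha_2=1$. For problem (P1) below, the hover-fly-hover (HFH) trajectory is optimal: there exist $-D/2\le x_{\rm I}\le x_{\rm F}\le D/2$ and $t_{\rm I},t_{\rm F}\ge0$ with $t_{\rm I}+(x_{\rm F}-x_{\rm I})/V+t_{\rm F}=T$ such that the trajectory $x(t)=x_{\rm I}$ for $t\in[0,t_{\rm I}]$, $x(t)=x_{\rm I}+(t-t_{\rm I})V$ for $t\in(t_{\rm I},T-t_{\rm F})$, $x(t)=x_{\rm F}$ for $t\in[T-t_{\rm F},T]$, together with a suitable power allocation, is optimal for (P1). Problem (P1): maximize $r$ over $(r,r_1,r_2,x,p_1,p_2)$ subject to $r_k\ge\alpha_kr$ ($k=1,2$), $(r_1,r_2)\in\mathcal{C}(x,p)$, $p_1(t)+p_2(t)\le\bar P$, $p_k(t)\ge0$, $|\dot x(t)|\le V$ for all $t\in[0,T]$.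
   Context: Fix $D>0$, $H>0$, $\beta_0>0$, $\bar P>0$. Ground users GU 1, GU 2 are at $x_1=-D/2$, $x_2=D/2$; for UAV horizontal position $x$ (altitude $H$), $h_k(x)=\beta_0/((x-x_k)^2+H^2)$. Trajectories are functions $x:[0,T]\to\mathbb{R}$, power allocations are measurable $p_1,p_2:[0,T]\to[0,\infty)$. $\mathcal{C}(x,p)$ is the set of $(r_1,r_2)$, $r_1,r_2\ge0$, with $r_1\le\frac1T\int_0^T\log_2(1+p_1(t)h_1(x(t)))dt$, $r_2\le\frac1T\int_0^T\log_2(1+p_2(t)h_2(x(t)))dt$, $r_1+r_2\le\frac1T\int_0^T\log_2(1+p_1(t)h_1(x(t))+p_2(t)h_2(x(t)))dt$. *)

(* Defs.v *)
From HB Require Import structures.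
From mathcomp Require Import all_boot all_order all_algebra.
From mathcomp Require Import all_classical all_reals all_analysis.
Set Implicit Arguments. Unset Strict Implicit. Unset Printing Implicit Defensive.
Import Order.TTheory GRing.Theory Num.Theory.
Import numFieldNormedType.Exports.
Local Open Scope classical_set_scope.
Local Open Scope ring_scope.

Section Defs.
Variable R : realType.

Definition gain (beta0 H xk x : R) : R := beta0 / ((x - xk) ^+ 2 + H ^+ 2).
Definition h1 (D H beta0 x : R) : R := gain beta0 H (- (D / 2)) x.
Definition h2 (D H beta0 x : R) : R := gain beta0 H (D / 2) x.

Definition log2 (y : R) : R := ln y / ln 2.

Definition avg (T : R) (f : R -> R) : R :=
  T^-1 * (\int[lebesgue_measure]_(t in `[0, T]) f t).

Definition in_capacity (D H beta0 T : R) (x p1 p2 : R -> R) (r1 r2 : R) : Prop :=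
  [/\ 0 <= r1, 0 <= r2,
      r1 <= avg T (fun t => log2 (1 + p1 t * h1 D H beta0 (x t))),
      r2 <= avg T (fun t => log2 (1 + p2 t * h2 D H beta0 (x t))) &
      r1 + r2 <= avg T (fun t => log2 (1 + p1 t * h1 D H beta0 (x t)
                                         + p2 t * h2 D H beta0 (x t)))].

(* speed constraint |x'(t)| <= V on [0,T], read as V-Lipschitz on [0,T] *)
Definition speed_ok (T V : R) (x : R -> R) : Prop :=
  forall s t, 0 <= s <= T -> 0 <= t <= T -> `|x t - x s| <= V * `|t - s|.

Definition power_ok (Pbar T : R) (p1 p2 : R -> R) : Prop :=
  [/\ measurable_fun `[0, T] p1, measurable_fun `[0, T] p2 &
      forall t, 0 <= t <= T -> [/\ 0 <= p1 t, 0 <= p2 t & p1 t + p2 t <= Pbar]].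

Definition P1_feasible (D H beta0 Pbar T V a1 a2 : R)
    (r r1 r2 : R) (x p1 p2 : R -> R) : Prop :=
  [/\ a1 * r <= r1, a2 * r <= r2,
      in_capacity D H beta0 T x p1 p2 r1 r2,
      power_ok Pbar T p1 p2 & speed_ok T V x].

Definition P1_optimal (D H beta0 Pbar T V a1 a2 : R)
    (r r1 r2 : R) (x p1 p2 : R -> R) : Prop :=
  P1_feasible D H beta0 Pbar T V a1 a2 r r1 r2 x p1 p2 /\
  forall r' r1' r2' x' p1' p2',
    P1_feasible D H beta0 Pbar T V a1 a2 r' r1' r2' x' p1' p2' -> r' <= r.

Definition hfh (T V xI xF tI tF : R) (t : R) : R :=
  if t <= tI then xI
  else if t < T - tF then xI + (t - tI) * V
  else xF.

End Defs.

(* Main.v *)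
(* Fix weights (1 - s, s) and let [value s x] be the best weighted sum rate at
   the fixed position x. A trajectory with range [xl, xr] crosses each point of
   the range at speed at most V, so its weighted rate is at most what is
   obtained by flying once over [xl, xr] and spending the rest of the time at a
   maximizer of [value s] on [xl, xr]. Now keep [xl, xr] fixed and vary s: by
   compactness there are a weight s and two maximizers y <= z whose rate pairs
   lie on opposite sides of the ray spanned by (a1, a2). Slide a window of
   length T along the path that hovers at y, flies to z and hovers at z. Every
   window is a hover-fly-hover trajectory that meets the bound of [xl, xr] for
   this s, and by the intermediate value theorem the rate pair of some window
   lies on the ray, so that its r is at least the r of any trajectory with
   range [xl, xr]. Since the bounds are closed conditions on (xl, xr), they
   also hold, for some range, for the supremum of all achievable r; hence the
   supremum is attained by a hover-fly-hover trajectory. *)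
Require Import Defs.
From HB Require Import structures.
From mathcomp Require Import all_boot all_order all_algebra.
From mathcomp Require Import all_classical all_reals all_analysis.
From mathcomp Require Import measurable_realfun.
From mathcomp Require Import ring lra.
Import Order.TTheory GRing.Theory Num.Theory.
Import numFieldNormedType.Exports.
Set Implicit Arguments.
Unset Strict Implicit.
Unset Printing Implicit Defensive.
Local Open Scope classical_set_scope.
Local Open Scope ring_scope.

(** * Integrals over compact intervals *)

Section integration.
Variable R : realType.
Implicit Types (f g : R -> R) (a b c : R).
Notation mu := (@lebesgue_measure R).

(** For [b < a] the interval is empty and the value is 0, not minus the reversed integral. *)
Definition integ a b f : R := \int[mu]_(t in `[a, b]) f t.

Definition integrable_on a b f := mu.-integrable `[a, b] (EFin \o f).

Lemma bounded_integrable_on a b C f : measurable_fun `[a, b] f ->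
  (forall t, a <= t <= b -> `|f t| <= C) -> integrable_on a b f.
Proof.
move=> mf fC; apply: measurable_bounded_integrable => //.
  by rewrite /= lebesgue_measure_itv/=; case: ifPn => // _; rewrite -EFinD ltry.
exists C; split; first exact: num_real.
by move=> x Cx t /= ; rewrite in_itv/= => /fC /le_trans; apply; apply: ltW.
Qed.

Lemma integrable_onD a b f g : integrable_on a b f -> integrable_on a b g ->
  integrable_on a b (fun t => f t + g t).
Proof. by move=> /integrableD/[apply] => /(_ (measurable_itv _)). Qed.

Lemma integrable_onZ a b k f : integrable_on a b f -> integrable_on a b (fun t => k * f t).
Proof. by move=> /integrableZl -/(_ (measurable_itv _) k). Qed.

Lemma integrable_on_cst a b k : integrable_on a b (fun=> k).
Proof. by apply: (@bounded_integrable_on _ _ `|k|) => //; exact: measurable_cst. Qed.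

Lemma continuous_integrable_on a b f : continuous f -> integrable_on a b f.
Proof.
move=> cf; apply: continuous_compact_integrable; first exact: segment_compact.
exact: continuous_subspaceT.
Qed.

Lemma integ_split a b c f : a <= b -> b <= c -> integrable_on a c f ->
  integ a c f = integ a b f + integ b c f.
Proof.
move=> ab bc fi; rewrite /integ; apply/eqP; rewrite addrC -subr_eq; apply/eqP.
rewrite Rintegral_itvB ?bnd_simp// Rintegral_itv_obnd_cbnd//.
apply: integrableS fi => //; apply: subset_itv => //; rewrite bnd_simp//.
Qed.

Lemma eq_integ a b f g : (forall t, a <= t <= b -> f t = g t) ->
  integ a b f = integ a b g.
Proof.
by move=> fg; apply: eq_Rintegral => t; rewrite inE/= in_itv/=; exact: fg.
Qed.

Lemma integ_le a b f g : integrable_on a b f -> integrable_on a b g ->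
  (forall t, a <= t <= b -> f t <= g t) -> integ a b f <= integ a b g.
Proof.
by move=> fi gi fg; apply: le_Rintegral.
Qed.

Lemma integD a b f g : integrable_on a b f -> integrable_on a b g ->
  integ a b (fun t => f t + g t) = integ a b f + integ a b g.
Proof. by move=> fi gi; rewrite /integ RintegralD. Qed.

Lemma integZ a b k f : integrable_on a b f ->
  integ a b (fun t => k * f t) = k * integ a b f.
Proof. by move=> fi; rewrite /integ RintegralZl. Qed.

Lemma integ_cst a b k : a <= b -> integ a b (fun=> k) = k * (b - a).
Proof.
move=> ab; rewrite /integ Rintegral_cst//= lebesgue_measure_itv/= lte_fin.
by case: ltgtP ab => //= -> _; rewrite subrr.
Qed.

Lemma integ_itv0 a f : integ a a f = 0.
Proof. by rewrite /integ set_itv1 Rintegral_set1. Qed.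

Lemma integ_dist a b C f : a <= b -> integrable_on a b f ->
  (forall t, a <= t <= b -> `|f t| <= C) -> `|integ a b f| <= C * (b - a).
Proof.
move=> ab fi fC; apply: le_trans (le_normr_Rintegral _ fi) _ => //.
rewrite -integ_cst//; apply: integ_le => //; last exact: integrable_on_cst.
exact: integrable_norm.
Qed.

(** Uniqueness of Lebesgue measure: its pushforward under a translation agrees with it on half-open
    intervals. *)
Lemma lebesgue_measure_shift w (A : set R) : measurable A ->
  mu A = mu ((fun t => w + t) @^-1` A).
Proof.
have mw : measurable_fun [set: measurableTypeR R]
    (fun t : measurableTypeR R => w + t : measurableTypeR R).
  exact: measurable_funD.
move=> mA.
apply: (@lebesgue_measure_unique R
  (measure_function_pushforward__canonical__measure_function_Measure mu mw)) => //.
move=> X [[a b] _ <-].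
rewrite /= /pushforward.
have -> : (fun t => w + t) @^-1` `]a, b]%classic = `](a - w), (b - w)]%classic.
  by apply/seteqP; split=> t /=; rewrite !in_itv/= ltrBlDl lerBrDl.
rewrite !lebesgue_measure_itv/= !lte_fin ltrD2r.
by case: ifPn => // _; rewrite -!EFinB; congr EFin; ring.
Qed.

Lemma integ_shift w a b C f : measurable_fun setT f -> (forall t, `|f t| <= C) ->
  integ (w + a) (w + b) f = integ a b (fun t => f (w + t)).
Proof.
move=> mf fC.
have mw : measurable_fun [set: measurableTypeR R]
    (fun t : measurableTypeR R => w + t : measurableTypeR R).
  exact: measurable_funD.
have fwi : integrable_on a b (fun t => f (w + t)).
  apply: (@bounded_integrable_on _ _ C) => //.
  by apply: measurable_funTS; exact: (measurableT_comp mf mw).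
rewrite /integ /Rintegral; congr fine.
have pre : (fun t => w + t) @^-1` `[w + a, w + b] = `[a, b]%classic.
  by apply/seteqP; split=> t /=; rewrite !in_itv/= !lerD2l.
rewrite (@eq_measure_integral _ _ _ _
  (measure_function_pushforward__canonical__measure_function_Measure mu mw)).
  rewrite integral_pushforward ?pre//.
  exact/measurable_EFinP.
by move=> A mA _; exact: lebesgue_measure_shift.
Qed.

End integration.

(** * Lipschitz functions and flight costs *)

Section lipschitz.
Variable R : realType.
Implicit Types (f g x psi F J : R -> R) (a b s t : R).

Definition lip L f := forall s t, `|f s - f t| <= L * `|s - t|.

Lemma lip_continuous L f : lip L f -> continuous f.
Proof.
move=> fL s; apply/cvgrPdist_le => e e0.
near=> t; apply: le_trans (fL _ _) _.
have L0 : 0 < `|L| + 1 by rewrite ltr_wpDl.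
apply: (@le_trans _ _ ((`|L| + 1) * `|s - t|)).
  by rewrite ler_wpM2r// (le_trans (ler_norm L))// lerDl.
rewrite -ler_pdivlMl// mulrC.
near: t; apply: cvgr_dist_le; first exact: cvg_id.
by rewrite divr_gt0.
Unshelve. all: by end_near. Qed.

Lemma lip_comp K L f g : 0 <= K -> lip K f -> lip L g -> lip (K * L) (f \o g).
Proof.
by move=> K0 fK gL s t; rewrite (le_trans (fK _ _))// -mulrA ler_wpM2l.
Qed.

(* Halving the interval halves the sum of the quadratic errors. *)
Lemma quadratic_error_le F J C a b : a <= b ->
  (forall s t, a <= s -> s <= t -> t <= b ->
     `|F t - F s| <= J t - J s + C * (t - s) ^+ 2) ->
  `|F b - F a| <= J b - J a.
Proof.
move=> ab FJ.
have step n s t : a <= s -> s <= t -> t <= b ->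
    `|F t - F s| <= J t - J s + C * (t - s) ^+ 2 / 2 ^+ n.
  elim: n s t => [|n IH] s t as_ st tb; first by rewrite expr0 divr1 FJ.
  pose m := (s + t) / 2.
  have sm : s <= m by rewrite /m; lra.
  have mt : m <= t by rewrite /m; lra.
  have := IH s m as_ sm (le_trans mt tb).
  have := IH m t (le_trans as_ sm) mt tb.
  have -> : (t - m) ^+ 2 = (t - s) ^+ 2 / 4 by rewrite /m; field.
  have -> : (m - s) ^+ 2 = (t - s) ^+ 2 / 4 by rewrite /m; field.
  have -> : C * (t - s) ^+ 2 / 2 ^+ n.+1 =
            2 * (C * ((t - s) ^+ 2 / 4) / 2 ^+ n).
    by rewrite (exprS 2 n); field; rewrite expf_neq0// pnatr_eq0.
  have : `|F t - F s| <= `|F t - F m| + `|F m - F s| by exact: ler_distD.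
  lra.
rewrite leNgt; apply/negP => gap.
set e := `|F b - F a| - (J b - J a).
have e0 : 0 < e by rewrite subr_gt0.
pose K := C * (b - a) ^+ 2.
(* Since [2 ^ n > n > |K| / e], the error after [n] halvings is smaller than the gap [e]. *)
pose n := (Num.truncn (`|K| / e)).+1.
have := step n a b (lexx _) ab (lexx _).
apply/negP; rewrite -ltNge -/K -ltrBrDl -/e.
rewrite ltr_pdivrMr ?exprn_gt0// mulrC -ltr_pdivrMr//.
apply: (@le_lt_trans _ _ (`|K| / e)).
  by rewrite ler_wpM2r ?invr_ge0 ?(ltW e0)// ler_norm.
apply: (@lt_trans _ _ n%:R); first exact: truncnS_gt.
by rewrite -natrX ltr_nat ltn_expl.
Qed.

(** Supplies the quadratic errors that [quadratic_error_le] removes. *)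
Lemma lip_int_linear L f a b : 0 <= L -> lip L f -> a <= b ->
  `|integ a b f - f a * (b - a)| <= L * (b - a) * (b - a).
Proof.
move=> L0 fL ab.
have fi : integrable_on a b f by apply: continuous_integrable_on; exact: lip_continuous fL.
have -> : integ a b f - f a * (b - a) = integ a b (fun t => f t + - f a).
  by rewrite integD ?integ_cst ?mulNr//; exact: integrable_on_cst.
apply: integ_dist => //; first by apply: integrable_onD => //; exact: integrable_on_cst.
move=> t /andP[at_ tb]; rewrite (le_trans (fL _ _))// ler_wpM2l//.
by rewrite ger0_norm ?subr_ge0// lerD2r.
Qed.

Section antiderivative.
Variables (psi : R -> R) (L : R).
Hypotheses (L0 : 0 <= L) (psiL : lip L psi).

Lemma lip_integrable_on a b : integrable_on a b psi.
Proof. by apply: continuous_integrable_on; exact: lip_continuous psiL. Qed.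

Lemma lip_int_upper a b : a <= b ->
  `|integ a b psi| <= (`|psi a| + L * (b - a)) * (b - a).
Proof.
move=> ab; apply: integ_dist => //; first exact: lip_integrable_on.
move=> t /andP[at_ tb].
have -> : psi t = psi a + (psi t - psi a) by ring.
rewrite (le_trans (ler_normD _ _))// lerD2l (le_trans (psiL _ _))// ler_wpM2l//.
by rewrite ger0_norm ?subr_ge0// lerD2r.
Qed.

Lemma lip_int_upper_r a b : a <= b ->
  `|integ a b psi| <= (`|psi b| + L * (b - a)) * (b - a).
Proof.
move=> ab; apply: integ_dist => //; first exact: lip_integrable_on.
move=> t /andP[at_ tb].
have -> : psi t = psi b + (psi t - psi b) by ring.
rewrite (le_trans (ler_normD _ _))// lerD2l (le_trans (psiL _ _))// ler_wpM2l//.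
by rewrite distrC ger0_norm ?subr_ge0// lerB.
Qed.

(** The bound uses the value at [a] on whichever side of [a] the endpoint [b] lies, as a trajectory
    may move both ways. *)
Lemma integ_sub A a b : A <= a -> A <= b ->
  `|integ A b psi - integ A a psi| <= (`|psi a| + L * `|b - a|) * `|b - a|.
Proof.
move=> Aa Ab; have [ab|/ltW ba] := leP a b.
  rewrite (integ_split Aa ab); last exact: lip_integrable_on.
  rewrite addrAC subrr add0r.
  by rewrite (ger0_norm (_ : 0 <= b - a)) ?subr_ge0// lip_int_upper.
rewrite (integ_split Ab ba); last exact: lip_integrable_on.
rewrite opprD addrA subrr add0r normrN distrC.
by rewrite (ger0_norm (_ : 0 <= a - b)) ?subr_ge0// lip_int_upper_r.
Qed.

(** Replaces a change of variables along [x] without differentiating it: over a short time the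
    antiderivative of [psi] changes by at most [psi (x s) * V * (t - s)] up to a quadratic error. *)
Lemma travel_cost A V x a b : a <= b -> 0 <= V -> lip V x ->
  (forall t, a <= t <= b -> A <= x t) ->
  (forall t, a <= t <= b -> 0 <= psi (x t)) ->
  `|integ A (x b) psi - integ A (x a) psi| <= V * integ a b (psi \o x).
Proof.
move=> ab V0 xV Ax psi0.
have cL := lip_comp L0 psiL xV.
have ci s t : integrable_on s t (psi \o x).
  by apply: continuous_integrable_on; exact: lip_continuous cL.
suff : `|integ A (x b) psi - integ A (x a) psi| <=
    V * integ a b (psi \o x) - V * integ a a (psi \o x).
  by rewrite integ_itv0 mulr0 subr0.
(* One [L * V ^+ 2] comes from the variation of [psi] over the distance covered, the other from
   freezing [psi \o x] at the left end of the time interval. *)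
apply: (@quadratic_error_le (fun t => integ A (x t) psi)
  (fun t => V * integ a t (psi \o x)) (2 * (L * V ^+ 2))) => // s t as_ st tb.
have sab : a <= s <= b by rewrite as_ (le_trans st tb).
have tab : a <= t <= b by rewrite tb (le_trans as_ st).
rewrite (integ_split as_ st)//.
have := lip_int_linear (mulr_ge0 L0 V0) cL st; rewrite /= ler_norml.
move=> /andP[lo _].
have := integ_sub (Ax _ sab) (Ax _ tab).
rewrite (ger0_norm (psi0 _ sab)).
have := xV t s; rewrite (ger0_norm (_ : 0 <= t - s)) ?subr_ge0//.
set d := `|x t - x s|; set p := psi (x s) in lo *; set I := integ s t _ in lo *.
set J := integ a s _.
move=> dV up.
have d0 : 0 <= d by rewrite normr_ge0.
have p0 : 0 <= p by exact: psi0.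
have : (p + L * d) * d <= (p + L * (V * (t - s))) * (V * (t - s)).
  by rewrite ler_pM ?addr_ge0 ?mulr_ge0// lerD2l ler_wpM2l.
have := ler_wpM2l V0 lo.
lra.
Qed.

(** At constant speed [travel_cost] becomes an equality: the difference [F] of the two sides has
    quadratic increments, hence is constant. *)
Lemma uniform_flight_cost V y c d : 0 <= V -> 0 <= d ->
  V * integ c (c + d) (fun t => psi (y + V * (t - c))) = integ y (y + V * d) psi.
Proof.
move=> V0 d0.
pose x t := y + V * (t - c).
have xV : lip V x.
  move=> s t; rewrite /x (_ : _ - _ = V * (s - t)); last by ring.
  by rewrite normrM (ger0_norm V0).
have cL := lip_comp L0 psiL xV.
have cd : c <= c + d by rewrite lerDl.
have xc : x c = y by rewrite /x subrr mulr0 addr0.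
have xd : x (c + d) = y + V * d by rewrite /x addrAC subrr add0r.
pose F t := V * integ c t (psi \o x) - integ y (x t) psi.
have : `|F (c + d) - F c| <= 0 - 0.
  apply: (@quadratic_error_le F (fun=> 0) (2 * (L * V ^+ 2))) => // s t cs st td.
  have xst : x s <= x t by rewrite /x lerD2l ler_wpM2l// lerD2r.
  have ys : y <= x s by rewrite /x lerDl mulr_ge0// subr_ge0.
  have xB : x t - x s = V * (t - s) by rewrite /x; ring.
  have := lip_int_linear L0 psiL xst; rewrite xB ler_norml => /andP[lo hi].
  have := lip_int_linear (mulr_ge0 L0 V0) cL st; rewrite ler_norml => /andP[].
  move=> /(ler_wpM2l V0) lo' /(ler_wpM2l V0) hi'.
  rewrite /F (integ_split cs st); last first.
    by apply: continuous_integrable_on; exact: lip_continuous cL.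
  rewrite (integ_split ys xst); last exact: lip_integrable_on.
  move: lo hi lo' hi' => /=; rewrite ler_norml.
  set I := integ s t _; set I' := integ (x s) _ _; set K := integ c s _.
  set p := psi (x s) => lo hi lo' hi'.
  by apply/andP; split; lra.
rewrite subr0 normr_le0 subr_eq0 => /eqP.
rewrite /F xc !integ_itv0 xd mulr0 subr0 => /eqP.
by rewrite subr_eq0 => /eqP.
Qed.

End antiderivative.

End lipschitz.

(** * Inequalities for the logarithm *)

Section logarithm.
Variable R : realType.
Implicit Types a b : R.

(** Concavity: the graph of the logarithm lies below its tangent at [a]. *)
Lemma ln_sub_le a b : 0 < a -> 0 < b -> ln b - ln a <= (b - a) / a.
Proof.
move=> a0 b0; rewrite -ln_div ?posrE// mulrBl divff ?gt_eqF//.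
have := @le_ln1Dx R (b / a - 1).
rewrite addrCA subrr addr0; apply.
by rewrite ltrBrDl subrr divr_gt0.
Qed.

Lemma ln_dist a b : 1 <= a -> 1 <= b -> `|ln a - ln b| <= `|a - b|.
Proof.
wlog ab : a b / a <= b => [wl a1 b1|a1 b1].
  have [/wl|/ltW/wl] := leP a b; first exact.
  by rewrite (distrC (ln a)) (distrC a); exact.
have a0 : 0 < a by rewrite (lt_le_trans _ a1).
rewrite distrC ger0_norm ?subr_ge0 ?ler_ln ?posrE ?(lt_le_trans a0)//.
rewrite distrC ger0_norm ?subr_ge0//.
apply: le_trans (ln_sub_le _ _) _ => //; first exact: lt_le_trans ab.
by rewrite ler_pdivrMr// ler_peMr// subr_ge0.
Qed.

Lemma ln_cvg T (F : set_system T) (f : T -> R) a : Filter F -> 0 < a ->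
  f @ F --> a -> (fun t => ln (f t)) @ F --> ln a.
Proof. by move=> FF a0 fa; apply: (continuous_cvg _ (continuous_ln a0)). Qed.

End logarithm.

(** * Optimal power split at one position *)

Section best_power.
Variable R : realType.
Variables m M g h P : R.

(* [p] is the power of the user with the smaller weight [m] and gain [g], who
   is decoded first. *)
Definition weighted_rate p :=
  m * ln (1 + p * g + (P - p) * h) + (M - m) * ln (1 + (P - p) * h).

(* For [h < g] the quotient is the zero of the derivative of the concave
   function [weighted_rate]. *)
Definition best_power :=
  if g <= h then 0 else
  Num.max 0 (Num.min P ((1 + P * h) * (m * g - M * h) / (M * h * (g - h)))).

Hypotheses (m0 : 0 <= m) (mM : m <= M) (M0 : 0 < M).
Hypotheses (g0 : 0 < g) (h0 : 0 < h) (P0 : 0 < P).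

Lemma best_power_itv : 0 <= best_power <= P.
Proof.
rewrite /best_power; case: ifPn => _; first by rewrite lexx ltW.
by rewrite le_max lexx/= ge_max ge_min lexx ltW.
Qed.

Lemma best_powerP p : 0 <= p <= P -> weighted_rate p <= weighted_rate best_power.
Proof.
move=> /andP[p0 pP]; have /andP[] := best_power_itv.
set q := best_power => q0 qP.
pose A r := 1 + r * g + (P - r) * h.
pose B r := 1 + (P - r) * h.
have Agt r : 0 <= r -> r <= P -> 0 < A r.
  move=> r0 rP; rewrite /A -addrA ltr_wpDr// addr_ge0// mulr_ge0 ?subr_ge0// ltW//.
have Bgt r : 0 <= r -> r <= P -> 0 < B r.
  by move=> r0 rP; rewrite /B ltr_wpDr// mulr_ge0 ?subr_ge0// ltW.
(* [N r / (A r * B r)] is the derivative of [weighted_rate] at [r]. Thus [key] is the first-order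
   condition for a maximum at [q], and the tangent inequality for [ln] makes it sufficient. *)
pose N r := (1 + P * h) * (m * g - M * h) - r * (M * h * (g - h)).
have key : (p - q) * N q <= 0.
  rewrite /N /q /best_power; case: ifPn => [gh|].
    rewrite mul0r !subr0 mulr_ge0_le0// mulr_ge0_le0//.
      by rewrite addr_ge0// mulr_ge0// ltW.
    by rewrite subr_le0 ler_pM// ltW.
  rewrite -ltNge => hg.
  have Q0 : 0 < M * h * (g - h) by rewrite !mulr_gt0// subr_gt0.
  set Nu := (1 + P * h) * (m * g - M * h).
  set Q := M * h * (g - h) in Q0 *.
  case: (leP (Nu / Q) P) => c1; case: (leP 0 _) => c2.
  - by rewrite divfK ?gt_eqF// subrr mulr0.
  - move: c2; rewrite pmulr_llt0 ?invr_gt0// => Nu0.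
    by rewrite mul0r !subr0 mulr_ge0_le0// ltW.
  - move: c1; rewrite ltr_pdivlMr// => c1.
    by rewrite mulr_le0_ge0 ?subr_le0// subr_ge0 ltW.
  - by move: c2; rewrite ltNge (ltW P0).
rewrite /weighted_rate -!/(A _) -!/(B _).
have HA := ler_wpM2l m0 (ln_sub_le (Agt q q0 qP) (Agt p p0 pP)).
have Mm : 0 <= M - m by rewrite subr_ge0.
have HB := ler_wpM2l Mm (ln_sub_le (Bgt q q0 qP) (Bgt p p0 pP)).
have : m * ((A p - A q) / A q) + (M - m) * ((B p - B q) / B q) <= 0.
  have -> : m * ((A p - A q) / A q) + (M - m) * ((B p - B q) / B q) =
      (p - q) * N q / (A q * B q).
    have := Bgt q q0 qP; have := Agt q q0 qP.
    rewrite /N /A /B => /lt0r_neq0 Aq /lt0r_neq0 Bq.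
    by field; rewrite Aq Bq.
  by rewrite pmulr_lle0// invr_gt0 mulr_gt0 ?Agt ?Bgt.
lra.
Qed.

End best_power.

(** * Projection onto an interval and hover-fly-hover paths *)

Section clamp.
Variable R : realType.
Implicit Types d s t y : R.

(** Used in three ways: as elapsed flight time, to extend trajectories beyond their time interval,
    and to project positions onto the segment between the users. *)
Definition clamp d t := Num.max 0 (Num.min t d).

Lemma clampP d t : 0 <= d ->
  [\/ t <= 0 /\ clamp d t = 0, (0 <= t /\ t <= d) /\ clamp d t = t |
      d <= t /\ clamp d t = d].
Proof.
move=> d0; rewrite /clamp; have [td|/ltW dt] := leP t d; last first.
  by rewrite (max_r d0); apply: Or33.
by have [t0|/ltW t0] := leP 0 t; [apply: Or32|apply: Or31].
Qed.

Lemma clamp_le0 d t : 0 <= d -> t <= 0 -> clamp d t = 0.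
Proof. by move=> d0 t0; case: (clampP t d0) => -[? ->]; lra. Qed.

Lemma clamp_id d t : 0 <= t <= d -> clamp d t = t.
Proof.
move=> /andP[t0 td]; have d0 := le_trans t0 td.
by case: (clampP t d0) => -[? ->]; lra.
Qed.

Lemma clamp_ge d t : 0 <= d -> d <= t -> clamp d t = d.
Proof. by move=> d0 dt; case: (clampP t d0) => -[? ->]; lra. Qed.

Lemma clamp_itv d t : 0 <= d -> 0 <= clamp d t <= d.
Proof. by move=> d0; case: (clampP t d0) => -[? ->]; lra. Qed.

Lemma clamp_le d s t : 0 <= d -> s <= t -> clamp d s <= clamp d t.
Proof.
by move=> d0 st; case: (clampP s d0) => -[? ->]; case: (clampP t d0) => -[? ->]; lra.
Qed.

Lemma clamp_lip d : 0 <= d -> lip 1 (clamp d).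
Proof.
move=> d0 s t; rewrite mul1r.
wlog st : s t / s <= t => [wl|].
  have [/wl//|/ltW/wl] := leP s t; by rewrite distrC (distrC t).
rewrite distrC (distrC s) (ger0_norm (_ : 0 <= t - s)) ?subr_ge0// ler_norml.
by case: (clampP s d0) => -[? ->]; case: (clampP t d0) => -[? ->];
  apply/andP; split; lra.
Qed.

(* The window of duration [T] starting at time [w] of the path that hovers at
   [y] until time 0, flies until time [d], and hovers afterwards. *)
Lemma hfh_window T V d w : 0 < T -> 0 <= d -> exists tI tF,
  [/\ 0 <= tI, 0 <= tF, tI + (clamp d (w + T) - clamp d w) + tF = T &
  forall y t, 0 <= t <= T ->
    hfh T V (y + V * clamp d w) (y + V * clamp d (w + T)) tI tF t =
    y + V * clamp d (w + t)].
Proof.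
move=> T0 d0.
have fly A y t u : y + V * A + (t - u) * V = y + V * (A + (t - u)) by ring.
have piece tI tF : 0 <= tI -> 0 <= tF ->
    tI + (clamp d (w + T) - clamp d w) + tF = T ->
    (forall t, 0 <= t <= tI -> clamp d (w + t) = clamp d w) ->
    (forall t, tI < t < T - tF -> clamp d (w + t) = clamp d w + (t - tI)) ->
    (forall t, tI < t -> T - tF <= t <= T -> clamp d (w + t) = clamp d (w + T)) ->
    exists tI tF, [/\ 0 <= tI, 0 <= tF,
      tI + (clamp d (w + T) - clamp d w) + tF = T &
      forall y t, 0 <= t <= T ->
        hfh T V (y + V * clamp d w) (y + V * clamp d (w + T)) tI tF t =
        y + V * clamp d (w + t)].
  move=> tI0 tF0 sumT H1 H2 H3; exists tI, tF; split => // y t /andP[t0 tT].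
  rewrite /hfh; case: ifPn => [tI1|]; first by rewrite H1// t0.
  rewrite -ltNge => tI1; case: ifPn => [tF1|]; first by rewrite fly H2// tI1.
  by rewrite -leNgt => tF1; rewrite H3// tF1.
(* The places of the two window ends relative to [[0, d]] determine the hovering times. Three of the
   nine cases contradict [T > 0]. *)
case: (clampP w d0) => -[w1 E1]; case: (clampP (w + T) d0) => -[w2 E2].
- apply: (piece T 0); rewrite ?E1 ?E2; [lra|lra|lra| | |];
  move=> t; case: (clampP (w + t) d0) => -[? ->]; lra.
- apply: (piece (- w) 0); rewrite ?E1 ?E2; [lra|lra|lra| | |];
  move=> t; case: (clampP (w + t) d0) => -[? ->]; lra.
- apply: (piece (- w) (w + T - d)); rewrite ?E1 ?E2; [lra|lra|lra| | |];
  move=> t; case: (clampP (w + t) d0) => -[? ->]; lra.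
- lra.
- apply: (piece 0 0); rewrite ?E1 ?E2; [lra|lra|lra| | |];
  move=> t; case: (clampP (w + t) d0) => -[? ->]; lra.
- apply: (piece 0 (w + T - d)); rewrite ?E1 ?E2; [lra|lra|lra| | |];
  move=> t; case: (clampP (w + t) d0) => -[? ->]; lra.
- lra.
- lra.
- apply: (piece 0 T); rewrite ?E1 ?E2; [lra|lra|lra| | |];
  move=> t; case: (clampP (w + t) d0) => -[? ->]; lra.
Qed.

End clamp.

(** * Rate pairs and weighted rates at a fixed position *)

Section broadcast.
Variable R : realType.
Variables (g1 g2 : R -> R) (K G P : R).
Hypotheses (K0 : 0 <= K) (P0 : 0 < P).
Hypotheses (g1K : lip K g1) (g2K : lip K g2).
Hypotheses (g1_gt0 : forall x, 0 < g1 x) (g2_gt0 : forall x, 0 < g2 x).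
Hypotheses (g1G : forall x, g1 x <= G) (g2G : forall x, g2 x <= G).

Implicit Types s x q l : R.

(** Natural logarithms, and the whole power budget in use: [q] for user 1 and [P - q] for user 2. *)
Definition C1 x q := ln (1 + q * g1 x).
Definition C2 x q := ln (1 + (P - q) * g2 x).
Definition C12 x q := ln (1 + q * g1 x + (P - q) * g2 x).

(* [l] moves along the dominant face [R1 + R2 = C12] of the capacity pentagon,
   from the corner [R1 = C1] (l = 0) to the corner [R2 = C2] (l = 1). *)
Definition rate1 x q l := (1 - l) * C1 x q + l * (C12 x q - C2 x q).
Definition rate2 x q l := (1 - l) * (C12 x q - C1 x q) + l * C2 x q.

Definition wrate s x q l := (1 - s) * rate1 x q l + s * rate2 x q l.

Definition unit_itv s := 0 <= s <= 1.
Definition power_itv q := 0 <= q <= P.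

Let snr x q (qP : power_itv q) : [/\ 0 <= q * g1 x, 0 <= (P - q) * g2 x &
  q * g1 x + (P - q) * g2 x <= P * G].
Proof.
case/andP: qP => q0 qP.
have a := ler_wpM2l q0 (g1G x).
have Pq : 0 <= P - q by rewrite subr_ge0.
have b := ler_wpM2l Pq (g2G x).
split; [by rewrite mulr_ge0// ltW| by rewrite mulr_ge0// ltW|lra].
Qed.

Lemma C1_le_C12 x q : power_itv q -> C1 x q <= C12 x q.
Proof.
move=> /(snr x) [a b _]; rewrite ler_ln ?posrE; lra.
Qed.

Lemma C2_le_C12 x q : power_itv q -> C2 x q <= C12 x q.
Proof.
move=> /(snr x) [a b _]; rewrite ler_ln ?posrE; lra.
Qed.

Lemma C12_le x q : power_itv q -> C12 x q <= C1 x q + C2 x q.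
Proof.
move=> /(snr x) [a b _]; rewrite -lnM ?posrE; [|lra|lra].
rewrite ler_ln ?posrE; [nra|lra|nra].
Qed.

Lemma C1_ge0 x q : power_itv q -> 0 <= C1 x q.
Proof. by move=> /(snr x) [a b _]; rewrite ln_ge0//; lra. Qed.

Lemma C2_ge0 x q : power_itv q -> 0 <= C2 x q.
Proof. by move=> /(snr x) [a b _]; rewrite ln_ge0//; lra. Qed.

Lemma C12_bound x q : power_itv q -> C12 x q <= P * G.
Proof.
move=> /(snr x) [a b c]; rewrite /C12 -addrA (le_trans (le_ln1Dx _))//.
by rewrite (lt_le_trans _ (addr_ge0 a b))// ltrN10.
Qed.

Lemma rate1_itv x q l : power_itv q -> unit_itv l -> 0 <= rate1 x q l <= C1 x q.
Proof.
move=> qP /andP[l0 l1].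
have := C1_ge0 x qP; have := C2_le_C12 x qP; have := C12_le x qP.
rewrite /rate1 => a b c; apply/andP; split; nra.
Qed.

Lemma rate2_itv x q l : power_itv q -> unit_itv l -> 0 <= rate2 x q l <= C2 x q.
Proof.
move=> qP /andP[l0 l1].
have := C2_ge0 x qP; have := C1_le_C12 x qP; have := C12_le x qP.
rewrite /rate2 => a b c; apply/andP; split; nra.
Qed.

Lemma rateD x q l : rate1 x q l + rate2 x q l = C12 x q.
Proof. by rewrite /rate1 /rate2; ring. Qed.

Lemma rate1_bound x q l : power_itv q -> unit_itv l -> `|rate1 x q l| <= P * G.
Proof.
move=> qP lU; have /andP[a b] := rate1_itv x qP lU.
by rewrite ger0_norm// (le_trans b)// (le_trans (C1_le_C12 _ _))// C12_bound.
Qed.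

Lemma rate2_bound x q l : power_itv q -> unit_itv l -> `|rate2 x q l| <= P * G.
Proof.
move=> qP lU; have /andP[a b] := rate2_itv x qP lU.
by rewrite ger0_norm// (le_trans b)// (le_trans (C2_le_C12 _ _))// C12_bound.
Qed.

(** An even power split gives both users a positive rate, so the sum is positive for every weight.
    This strictness later permits a division in [hfh_optimal]. *)
Lemma wrate_gt0 s x : unit_itv s -> 0 < wrate s x (P / 2) 0.
Proof.
move=> /andP[s0 s1]; rewrite /wrate /rate1 /rate2 subr0 !mul0r !mul1r !addr0.
have a : 0 < P / 2 * g1 x by rewrite mulr_gt0// divr_gt0.
have b : 0 < (P - P / 2) * g2 x by rewrite mulr_gt0//; have := P0; lra.
have c1 : 0 < C1 x (P / 2) by rewrite ln_gt0//; lra.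
have c2 : 0 < C12 x (P / 2) - C1 x (P / 2).
  by rewrite subr_gt0 ltr_ln ?posrE; lra.
have [->|s_gt0] := eqVneq s 0; first by rewrite subr0 mul1r mul0r addr0.
by rewrite ltr_wpDl// ?mulr_ge0 ?mulr_gt0 ?subr_ge0// ?ltW// lt0r s_gt0.
Qed.

(** The factor 3 counts the capacities [C1], [C2] and [C12]: each is Lipschitz with constant [P * K]
    and enters with a coefficient of absolute value at most 1. *)
Lemma wrate_lip s q l : unit_itv s -> power_itv q -> unit_itv l ->
  lip (3 * (P * K)) (wrate s ^~ q ^~ l).
Proof.
move=> sU qP lU x y.
have [a b _] := snr x qP; have [a' b' _] := snr y qP.
case/andP: (qP) => q0 qP'.
have d1 : `|q * g1 x - q * g1 y| <= q * (K * `|x - y|).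
  by rewrite -mulrBr normrM (ger0_norm q0) ler_wpM2l.
have d2 : `|(P - q) * g2 x - (P - q) * g2 y| <= (P - q) * (K * `|x - y|).
  by rewrite -mulrBr normrM ger0_norm ?ler_wpM2l// subr_ge0.
have e0 : 0 <= K * `|x - y| by rewrite mulr_ge0.
have c1 : `|C1 x q - C1 y q| <= P * (K * `|x - y|).
  apply: le_trans (ln_dist _ _) _; [lra|lra|].
  rewrite (_ : _ - _ = q * g1 x - q * g1 y); last by ring.
  by rewrite (le_trans d1)// ler_wpM2r.
have c2 : `|C2 x q - C2 y q| <= P * (K * `|x - y|).
  apply: le_trans (ln_dist _ _) _; [lra|lra|].
  rewrite (_ : _ - _ = (P - q) * g2 x - (P - q) * g2 y); last by ring.
  by rewrite (le_trans d2)// ler_wpM2r// gerBl.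
have c12 : `|C12 x q - C12 y q| <= P * (K * `|x - y|).
  apply: le_trans (ln_dist _ _) _; [lra|lra|].
  rewrite (_ : _ - _ = (q * g1 x - q * g1 y) +
     ((P - q) * g2 x - (P - q) * g2 y)); last by ring.
  rewrite (le_trans (ler_normD _ _))// (le_trans (lerD d1 d2))//.
  by rewrite -mulrDl addrC subrK.
have -> : wrate s x q l - wrate s y q l =
    (1 - 2 * s) * (1 - l) * (C1 x q - C1 y q) +
    ((2 * s - 1) * l * (C2 x q - C2 y q) +
    ((1 - s) * l + s * (1 - l)) * (C12 x q - C12 y q)).
  by rewrite /wrate /rate1 /rate2; ring.
have coef c d : `|c| <= 1 -> `|d| <= P * (K * `|x - y|) ->
    `|c * d| <= P * (K * `|x - y|).
  by move=> c1' dd; rewrite normrM (le_trans _ dd)// ler_piMl.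
case/andP: sU => s0 s1; case/andP: lU => l0 l1.
apply: le_trans (ler_normD _ _) _.
rewrite (_ : 3 * _ * _ = P * (K * `|x - y|) + (P * (K * `|x - y|) +
  P * (K * `|x - y|))); last by ring.
apply: lerD; first by apply: coef => //; rewrite ler_norml; apply/andP; split; nra.
apply: le_trans (ler_normD _ _) _.
by apply: lerD; apply: coef => //; rewrite ler_norml; apply/andP; split; nra.
Qed.

(** Joint continuity, stated along an arbitrary filter so that it applies to limits along
    ultrafilters. *)
Lemma wrate_cvg T (F : set_system T) (fs fx fq fl : T -> R) s x q l :
  Filter F -> power_itv q ->
  fs @ F --> s -> fx @ F --> x -> fq @ F --> q -> fl @ F --> l ->
  [/\ (fun t => rate1 (fx t) (fq t) (fl t)) @ F --> rate1 x q l,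
      (fun t => rate2 (fx t) (fq t) (fl t)) @ F --> rate2 x q l &
      (fun t => wrate (fs t) (fx t) (fq t) (fl t)) @ F --> wrate s x q l].
Proof.
move=> FF qP hs hx hq hl.
have [a b _] := snr x qP.
have h1 : (fun t => g1 (fx t)) @ F --> g1 x.
  exact: (cvg_comp _ _ hx (@lip_continuous _ _ _ g1K x)).
have h2 : (fun t => g2 (fx t)) @ F --> g2 x.
  exact: (cvg_comp _ _ hx (@lip_continuous _ _ _ g2K x)).
have hP : (fun t => P - fq t) @ F --> P - q by apply: cvgB => //; exact: cvg_cst.
have k1 : (fun t => 1 + fq t * g1 (fx t)) @ F --> 1 + q * g1 x.
  by apply: cvgD; [exact: cvg_cst|exact: cvgM].
have c1 : (fun t => C1 (fx t) (fq t)) @ F --> C1 x q by apply: ln_cvg => //; lra.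
have c2 : (fun t => C2 (fx t) (fq t)) @ F --> C2 x q.
  by apply: ln_cvg; [lra|apply: cvgD; [exact: cvg_cst|exact: cvgM]].
have c12 : (fun t => C12 (fx t) (fq t)) @ F --> C12 x q.
  by apply: ln_cvg; [lra|apply: cvgD => //; exact: cvgM].
have hl1 : (fun t => 1 - fl t) @ F --> 1 - l by apply: cvgB => //; exact: cvg_cst.
have hs1 : (fun t => 1 - fs t) @ F --> 1 - s by apply: cvgB => //; exact: cvg_cst.
have r1 : (fun t => rate1 (fx t) (fq t) (fl t)) @ F --> rate1 x q l.
  by apply: cvgD; apply: cvgM => //; exact: cvgB.
have r2 : (fun t => rate2 (fx t) (fq t) (fl t)) @ F --> rate2 x q l.
  by apply: cvgD; apply: cvgM => //; exact: cvgB.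
by split => //; apply: cvgD; apply: cvgM.
Qed.

(** For [s <= 1/2] user 2 has the smaller weight, so [best_power] is its power and user 1 gets the
    rest. The explicit formula makes the choice measurable in [x]. *)
Definition best_q s x :=
  if s <= 2^-1 then P - best_power s (1 - s) (g2 x) (g1 x) P
  else best_power (1 - s) s (g1 x) (g2 x) P.

Definition best_l s : R := if s <= 2^-1 then 0 else 1.

Definition value s x := wrate s x (best_q s x) (best_l s).

Lemma best_l_itv s : unit_itv (best_l s).
Proof. by rewrite /best_l /unit_itv; case: ifP; rewrite lexx ler01. Qed.

Lemma best_q_itv s x : unit_itv s -> power_itv (best_q s x).
Proof.
move=> /andP[s0 s1]; rewrite /best_q /power_itv; case: ifPn => s2.
  by have /andP[a b] := best_power_itv s (1 - s) (g2 x) (g1 x) P0; rewrite subr_ge0 b gerBl.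
exact: best_power_itv.
Qed.

Lemma wrate_corner1 s x q :
  wrate s x q 0 = weighted_rate s (1 - s) (g2 x) (g1 x) P (P - q).
Proof.
rewrite /wrate /rate1 /rate2 /weighted_rate /C12 /C1 opprB (addrCA P) subrr addr0.
by rewrite (addrAC 1 (q * _)); ring.
Qed.

Lemma wrate_corner2 s x q :
  wrate s x q 1 = weighted_rate (1 - s) s (g1 x) (g2 x) P q.
Proof. by rewrite /wrate /rate1 /rate2 /weighted_rate /C12 /C2; ring. Qed.

(** [wrate] is affine in [l] with slope [(2 s - 1) (C1 + C2 - C12)], whose sign is that of [2 s - 1]
    or 0. Hence a corner is optimal, and there [best_powerP] applies. *)
Lemma wrate_le_value s x q l : unit_itv s -> power_itv q -> unit_itv l ->
  wrate s x q l <= value s x.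
Proof.
move=> /andP[s0 s1] qP /andP[l0 l1].
have : 0 <= C1 x q + C2 x q - C12 x q by rewrite subr_ge0 C12_le.
rewrite /value /best_q /best_l; case: ifPn => s2 gap.
  have PqP : 0 <= P - q <= P.
    by move/andP: qP => [a b]; rewrite subr_ge0 b gerBl.
  have M0 : 0 < 1 - s by lra.
  have mM : s <= 1 - s by lra.
  apply: (@le_trans _ _ (wrate s x q 0)).
    have s3 : 0 <= 1 - 2 * s by lra.
    have := mulr_ge0 (mulr_ge0 l0 s3) gap; rewrite /wrate /rate1 /rate2; lra.
  rewrite !wrate_corner1 opprB (addrCA P) subrr addr0.
  exact: (best_powerP s0 mM M0).
have {}s2 : 2^-1 < s by rewrite ltNge.
have s10 : 0 <= 1 - s by lra.
have M0 : 0 < s by lra.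
have mM : 1 - s <= s by lra.
apply: (@le_trans _ _ (wrate s x q 1)).
  have s3 : 0 <= 2 * s - 1 by lra.
  have l3 : 0 <= 1 - l by lra.
  have := mulr_ge0 (mulr_ge0 l3 s3) gap; rewrite /wrate /rate1 /rate2; lra.
by rewrite !wrate_corner2; exact: (best_powerP s10 mM M0).
Qed.

Lemma value_gt0 s x : unit_itv s -> 0 < value s x.
Proof.
move=> sU; apply: lt_le_trans (wrate_gt0 x sU) (wrate_le_value _ _ _ _) => //.
  by rewrite /power_itv; apply/andP; split; have := P0; lra.
by rewrite /unit_itv lexx ler01.
Qed.

(** A pointwise maximum of functions with a common Lipschitz constant: the optimal power at one
    point is a competitor at the other. *)
Lemma value_lip s : unit_itv s -> lip (3 * (P * K)) (value s).
Proof.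
move=> sU x y.
have half a b : value s a - value s b <= 3 * (P * K) * `|a - b|.
  apply: le_trans (le_trans (ler_norm _)
    (wrate_lip sU (best_q_itv a sU) (best_l_itv s) a b)).
  rewrite lerB//; apply: wrate_le_value => //; first exact: best_q_itv.
  exact: best_l_itv.
by rewrite ler_norml lerNl opprB {1}distrC !half.
Qed.

Lemma measurable_best_power (m M : R) (g h : R -> R) : 0 < M ->
  measurable_fun setT g -> measurable_fun setT h -> (forall t, 0 < h t) ->
  measurable_fun setT (fun t => best_power m M (g t) (h t) P).
Proof.
move=> M0 mg mh h0.
(* On the branch where it occurs the divisor is positive, so its inverse is the exponential of minus
   its logarithm, a composition of measurable functions. *)
pose f t := if g t <= h t then 0 else Num.max 0 (Num.min P
  ((1 + P * h t) * (m * g t - M * h t) * expR (- ln (M * h t * (g t - h t))))).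
have -> : (fun t => best_power m M (g t) (h t) P) = f.
  apply/funext => t; rewrite /best_power /f; case: (leP (g t) (h t)) => // hg.
  by rewrite expRN lnK// posrE !mulr_gt0// subr_gt0.
have mN : measurable_fun setT (fun t => (1 + P * h t) * (m * g t - M * h t)).
  apply: measurable_funM; first by apply: measurable_funD => //; exact: measurable_funM.
  by apply: measurable_funB; exact: measurable_funM.
have mQ : measurable_fun setT (fun t => M * h t * (g t - h t)).
  by apply: measurable_funM; [exact: measurable_funM|exact: measurable_funB].
apply: measurable_fun_ifT => //; first exact: measurable_fun_ler.
apply: measurable_maxr => //; apply: measurable_minr => //.
apply: measurable_funM => //.
by apply: measurableT_comp => //; apply: measurable_funN; exact: measurableT_comp.
Qed.

Lemma lip_measurable (L : R) (f : R -> R) : lip L f -> measurable_fun setT f.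
Proof. by move=> fL; apply: continuous_measurable_fun; exact: lip_continuous fL. Qed.

Lemma measurable_best_q s : unit_itv s -> measurable_fun setT (best_q s).
Proof.
move=> /andP[s0 s1]; rewrite /best_q; case: (leP s 2^-1) => s2.
  apply: measurable_funB => //; apply: measurable_best_power => //.
  - by lra.
  - exact: lip_measurable g2K.
  - exact: lip_measurable g1K.
apply: measurable_best_power => //.
- by lra.
- exact: lip_measurable g1K.
- exact: lip_measurable g2K.
Qed.

(** Compactness gives a cluster point, which for an ultrafilter is a limit. One ultrafilter serves
    several sequences at once, in place of nested subsequences. *)
Lemma ultra_lim (U : set_system nat) (f : nat -> R) (a b : R) :
  UltraFilter U -> (forall n, a <= f n <= b) ->
  exists2 c, a <= c <= b & f @ U --> c.
Proof.
move=> UU fab; have [|c [/=]] := @segment_compact R a b (f @ U)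
  (fmap_proper_filter f ultra_proper).
  rewrite -[_ _]/(U (f @^-1` `[a, b]%classic)).
  by apply: filterE => n /=; rewrite in_itv/=; exact: fab.
rewrite in_itv/= => cab cc; exists c => // B cB.
have [//|nB] := in_ultra_setVsetC (f @^-1` B) UU.
by have [t []] := cc (~` B) B nB cB.
Qed.

Lemma value_argmax xl xr s : xl <= xr -> unit_itv s ->
  exists2 x, xl <= x <= xr & forall y, xl <= y <= xr -> value s y <= value s x.
Proof.
move=> xlr sU.
have [|x] := @EVT_max R (value s) xl xr xlr.
  by apply: continuous_subspaceT; exact: lip_continuous (value_lip sU).
by rewrite in_itv/= => xI xmax; exists x => // y yI; apply: xmax; rewrite in_itv.
Qed.

(** * Maximizers on both sides of the ray *)

Section support.
Variables (xl xr a1 a2 : R).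
Hypotheses (xlr : xl <= xr) (a10 : 0 <= a1) (a20 : 0 <= a2).

(** Power and face parameter are included because one position may admit several optimal rate pairs:
    at [s = 1/2] every [l] is optimal. *)
Definition maximizer s x q l := [/\ xl <= x <= xr, power_itv q, unit_itv l &
  forall y, xl <= y <= xr -> value s y <= wrate s x q l].

(** Cross product of [(a1, a2)] with the rate pair: it is positive when user 2 gets more than its
    share and zero on the ray. *)
Definition imbalance x q l := a1 * rate2 x q l - a2 * rate1 x q l.

Lemma maximizer_ex s : unit_itv s -> exists x, maximizer s x (best_q s x) (best_l s).
Proof.
move=> sU; have [x xI xmax] := value_argmax xlr sU.
by exists x; split => //; [exact: best_q_itv|exact: best_l_itv].
Qed.

(** Compactness and continuity of [wrate]. The factor [c] is later -1 or 1, which covers both sides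
    of the ray. *)
Lemma maximizer_closed (c : R) (s_ : nat -> R) s :
  (forall n, unit_itv (s_ n)) -> s_ @ \oo --> s ->
  (forall n, exists x q l, maximizer (s_ n) x q l /\ 0 <= c * imbalance x q l) ->
  exists x q l, maximizer s x q l /\ 0 <= c * imbalance x q l.
Proof.
move=> sU ss H.
have [U [UU oU]] := @ultraFilterLemma nat \oo _.
have {}ss : s_ @ U --> s by apply: cvg_trans ss => A /oU.
have sU' : unit_itv s.
  apply/andP; split.
    by apply: (cvgr_to_ge ss); apply: filterE => n; case/andP: (sU n).
  by apply: (cvgr_to_le ss); apply: filterE => n; case/andP: (sU n).
have [x_ {}H] := choice H; have [q_ {}H] := choice H; have [l_ {}H] := choice H.
have [x xI xc] : exists2 x, xl <= x <= xr & x_ @ U --> x.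
  by apply: ultra_lim => n; case: (H n) => -[].
have [q qI qc] : exists2 q : R, 0 <= q <= P & q_ @ U --> q.
  by apply: ultra_lim => n; case: (H n) => -[].
have [l lI lc] : exists2 l : R, 0 <= l <= 1 & l_ @ U --> l.
  by apply: ultra_lim => n; case: (H n) => -[].
have [r1c r2c wc] := wrate_cvg _ qI ss xc qc lc.
exists x, q, l; split; last first.
  have ic : (fun n => c * imbalance (x_ n) (q_ n) (l_ n)) @ U -->
      c * imbalance x q l.
    have i1 : (fun n => a1 * rate2 (x_ n) (q_ n) (l_ n)) @ U -->
        a1 * rate2 x q l by apply: cvgM => //; exact: cvg_cst.
    have i2 : (fun n => a2 * rate1 (x_ n) (q_ n) (l_ n)) @ U -->
        a2 * rate1 x q l by apply: cvgM => //; exact: cvg_cst.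
    by apply: cvgM; [exact: cvg_cst|exact: cvgB].
  by apply: (cvgr_to_ge ic); apply: filterE => n; case: (H n).
split => // y yI.
(* At [y] the parameters optimal for the limit weight are frozen: they compete in each
   [value (s_ n) y], and continuity of [wrate] in the weight suffices. *)
have [_ _ vc] := wrate_cvg _ (best_q_itv y sU') ss (cvg_cst y : _ @ U --> _)
  (cvg_cst (best_q s y) : _ @ U --> _) (cvg_cst (best_l s) : _ @ U --> _).
apply: (ler_cvg_to vc wc); apply: filterE => n.
have [[_ _ _ vmax] _] := H n; apply: le_trans (vmax y yI).
by apply: wrate_le_value => //; [exact: best_q_itv|exact: best_l_itv].
Qed.

(** At weight 0 only user 1 counts; it receives all the power, and the rate of user 2 is 0. *)
Lemma maximizer0 : exists x q l, maximizer 0 x q l /\ imbalance x q l <= 0.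
Proof.
have u0 : unit_itv (0 : R) by rewrite /unit_itv lexx ler01.
have PP : power_itv P by rewrite /power_itv lexx ltW.
have [x xI xmax] := value_argmax xlr u0.
exists x, P, 0; split; last first.
  rewrite /imbalance /rate2 /C12 /C1 subrr mul0r !addr0 subrr mulr0 mul0r.
  rewrite addr0 mulr0 sub0r oppr_le0 mulr_ge0//.
  by have /andP[] := rate1_itv x PP u0.
split => // y yI; apply: le_trans (xmax y yI) _.
have qb := best_q_itv x u0.
have /andP[q0 qP] := qb.
rewrite /value /wrate subr0 !mul1r !mul0r !addr0.
have /andP[_ /le_trans] := rate1_itv x qb (best_l_itv 0); apply.
rewrite /rate1 subr0 mul1r mul0r addr0 ler_ln ?posrE; last 2 first.
- by rewrite ltr_wpDr// mulr_ge0// ltW.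
- by rewrite ltr_wpDr// mulr_ge0// ltW.
by rewrite lerD2l ler_wpM2r// ltW.
Qed.

Lemma maximizer1 : exists x q l, maximizer 1 x q l /\ 0 <= imbalance x q l.
Proof.
have u1 : unit_itv (1 : R) by rewrite /unit_itv lexx ler01.
have P0' : power_itv 0 by rewrite /power_itv lexx ltW.
have [x xI xmax] := value_argmax xlr u1.
exists x, 0, 1; split; last first.
  rewrite /imbalance /rate1 /C12 /C2 subr0 mul0r addr0 subrr mul1r mul0r subrr.
  rewrite addr0 mulr0 subr0 mulr_ge0//.
  by have /andP[] := rate2_itv x P0' u1.
split => // y yI; apply: le_trans (xmax y yI) _.
have qb := best_q_itv x u1.
have /andP[q0 qP] := qb.
rewrite /value /wrate subrr !mul1r !mul0r !add0r.
have /andP[_ /le_trans] := rate2_itv x qb (best_l_itv 1); apply.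
rewrite /rate2 subrr mul0r add0r mul1r ler_ln ?posrE; last 2 first.
- by rewrite ltr_wpDr// mulr_ge0 ?subr_ge0// ltW.
- by rewrite ltr_wpDr// mulr_ge0 ?subr_ge0// ltW.
by rewrite lerD2l ler_wpM2r ?lerB// ltW.
Qed.

(* [s] is the largest weight for which some maximizer favours user 1; it is
   also a limit of weights whose maximizers favour user 2. *)
Lemma balanced_weight : exists s, unit_itv s /\
  (exists x q l, maximizer s x q l /\ imbalance x q l <= 0) /\
  (exists x q l, maximizer s x q l /\ 0 <= imbalance x q l).
Proof.
pose S : set R := [set s | unit_itv s /\
  exists x q l, maximizer s x q l /\ imbalance x q l <= 0].
have S0 : S 0 by split; [rewrite /unit_itv lexx ler01|exact: maximizer0].
have hS : has_sup S by split; [exists 0|exists 1 => s [/andP[]]].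
set s := sup S.
have s0 : 0 <= s by apply: ub_le_sup S0; case: hS.
have s1 : s <= 1 by apply: ge_sup; [exists 0|move=> t [/andP[]]].
have sU : unit_itv s by rewrite /unit_itv s0 s1.
have h0 n : 0 < n.+1%:R^-1 :> R by rewrite invr_gt0 ltr0n.
exists s; split => //; split.
  have ex n : exists t, S t /\ s - n.+1%:R^-1 < t.
    by have [t St lt] := sup_adherent (h0 n) hS; exists t.
  have [t_ tP] := choice ex.
  have tU n : unit_itv (t_ n) by case: (tP n) => -[].
  have ts : t_ @ \oo --> s.
    apply: (@squeeze_cvgr _ _ _ _ (fun n => s - n.+1%:R^-1) (fun=> s)).
    - apply: nearW => n; have [St lt] := tP n; rewrite (ltW lt)/=.
      by apply: ub_le_sup St; case: hS.
    - rewrite -[X in _ --> X]subr0; apply: cvgB; first exact: cvg_cst.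
      exact: cvg_harmonic.
    - exact: cvg_cst.
  have [n|x [q [l [mx xi]]]] := @maximizer_closed (-1) t_ s tU ts.
    have [[_ [x [q [l [mx xi]]]]] _] := tP n.
    by exists x, q, l; rewrite mulN1r oppr_ge0.
  by exists x, q, l; rewrite mulN1r oppr_ge0 in xi.
(* There is no larger admissible weight at [s = 1], where [maximizer1] takes over. Otherwise the
   weights [t_ n] decrease to [s] from outside [S], so their maximizers all have positive
   imbalance. *)
have [->|sN1] := eqVneq s 1; first exact: maximizer1.
have s_lt1 : s < 1 by rewrite lt_neqAle sN1.
pose t_ n := s + (1 - s) * n.+1%:R^-1.
have st n : s < t_ n by rewrite ltrDl mulr_gt0// subr_gt0.
have tU n : unit_itv (t_ n).
  apply/andP; split; first by rewrite (le_trans s0)// ltW.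
  rewrite -lerBrDl ler_piMr ?subr_ge0// invf_le1 ?ltr0n// ler1n//.
have ts : t_ @ \oo --> s.
  rewrite -[X in _ --> X]addr0 -(mulr0 (1 - s)).
  apply: cvgD; first exact: cvg_cst.
  by apply: cvgM; [exact: cvg_cst|exact: cvg_harmonic].
have [n|x [q [l [mx xi]]]] := @maximizer_closed 1 t_ s tU ts.
  have [x mx] := maximizer_ex (tU n).
  exists x, (best_q (t_ n) x), (best_l (t_ n)); split => //; rewrite mul1r.
  rewrite leNgt; apply/negP => neg; have := st n; rewrite ltNge => /negP; apply.
  apply: ub_le_sup; first by case: hS.
  split; first exact: tU.
  by exists x, (best_q (t_ n) x), (best_l (t_ n)); split => //; exact: ltW.
by exists x, q, l; rewrite mul1r in xi.
Qed.

End support.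

Lemma measurable_rates (D : set R) (fx fq fl : R -> R) : measurable D ->
  measurable_fun D fx -> measurable_fun D fq -> measurable_fun D fl ->
  measurable_fun D (fun t => rate1 (fx t) (fq t) (fl t)) /\
  measurable_fun D (fun t => rate2 (fx t) (fq t) (fl t)).
Proof.
move=> mD mx mq ml.
have m1 : measurable_fun D (fun t => g1 (fx t)).
  by apply: (measurableT_comp _ mx); exact: lip_measurable g1K.
have m2 : measurable_fun D (fun t => g2 (fx t)).
  by apply: (measurableT_comp _ mx); exact: lip_measurable g2K.
have mq1 : measurable_fun D (fun t => fq t * g1 (fx t)) by exact: measurable_funM.
have mq2 : measurable_fun D (fun t => (P - fq t) * g2 (fx t)).
  by apply: measurable_funM => //; exact: measurable_funB.
have c1 : measurable_fun D (fun t => C1 (fx t) (fq t)).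
  by apply: measurableT_comp => //; exact: measurable_funD.
have c2 : measurable_fun D (fun t => C2 (fx t) (fq t)).
  by apply: measurableT_comp => //; exact: measurable_funD.
have c12 : measurable_fun D (fun t => C12 (fx t) (fq t)).
  by apply: measurableT_comp => //; apply: measurable_funD => //; exact: measurable_funD.
have ml1 : measurable_fun D (fun t => 1 - fl t) by exact: measurable_funB.
by split; apply: measurable_funD; apply: measurable_funM => //; exact: measurable_funB.
Qed.

(** Holds on the whole line because the integral vanishes for upper limits below [A]. *)
Lemma bounded_int_lip (A C : R) (f : R -> R) : 0 <= C ->
  measurable_fun setT f -> (forall t, `|f t| <= C) -> lip C (fun t => integ A t f).
Proof.
move=> C0 mf fC.
have fi a b : integrable_on a b f.
  by apply: (@bounded_integrable_on _ _ _ C) => //; exact: measurable_funTS.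
move=> s t; wlog st : s t / s <= t => [wl|].
  have [/wl//|/ltW/wl] := leP s t; by rewrite distrC (distrC t).
rewrite distrC (distrC s) (ger0_norm (_ : 0 <= t - s)) ?subr_ge0//.
have empty b : b < A -> integ A b f = 0.
  by move=> bA; rewrite /integ set_itv_ge ?Rintegral_set0// bnd_simp -ltNge.
have [As|sA] := leP A s.
  by rewrite (integ_split As st)// addrAC subrr add0r integ_dist.
rewrite (empty s sA) subr0; have [At|tA] := leP A t.
  apply: le_trans (integ_dist At _ (fun u _ => fC u)) _ => //.
  by rewrite ler_wpM2l// lerB// ltW.
by rewrite empty// normr0 mulr_ge0// subr_ge0.
Qed.


(** * Construction of a balanced hover-fly-hover schedule *)

Section window.
Variables (T V xl xr a1 a2 : R).
Hypotheses (T0 : 0 < T) (V0 : 0 < V) (xlr : xl <= xr) (xrV : xr - xl <= V * T).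
Hypotheses (a10 : 0 <= a1) (a20 : 0 <= a2).

Lemma maximizer_value s x q l : unit_itv s -> maximizer xl xr s x q l ->
  wrate s x q l = value s x.
Proof.
move=> sU [xI qP lU vmax]; apply/eqP; rewrite eq_le vmax// andbT.
exact: wrate_le_value.
Qed.

(** Sorting the two maximizers by position loses track of which user each one favours, hence the
    disjunction. *)
Lemma balanced_endpoints : exists s y qy ly z qz lz, [/\ unit_itv s,
  maximizer xl xr s y qy ly, maximizer xl xr s z qz lz, y <= z &
  (imbalance a1 a2 y qy ly <= 0 <= imbalance a1 a2 z qz lz) \/
  (imbalance a1 a2 z qz lz <= 0 <= imbalance a1 a2 y qy ly)].
Proof.
have [s [sU [[y [qy [ly [my iy]]]] [z [qz [lz [mz iz]]]]]]] :=
  balanced_weight xlr a10 a20.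
exists s; have [yz|/ltW zy] := leP y z.
  by exists y, qy, ly, z, qz, lz; split => //; left; rewrite iy iz.
by exists z, qz, lz, y, qy, ly; split => //; right; rewrite iy iz.
Qed.

(* Windows of duration [T] of the path that hovers at [y], flies to [z] and
   hovers there are HFH trajectories; by the intermediate value theorem one of
   them balances the rates. Each loses at most the flight cost over [y, z]
   against hovering at a maximizer, while a trajectory of range [xl, xr] loses
   at least the flight cost over [xl, xr]. *)
Lemma hfh_schedule : exists s, unit_itv s /\ exists xI xF tI tF,
  [/\ xl <= xI, xI <= xF, xF <= xr &
    [/\ 0 <= tI, 0 <= tF & tI + (xF - xI) / V + tF = T]] /\
  speed_ok T V (hfh T V xI xF tI tF) /\
  exists q l : R -> R, [/\ measurable_fun setT q, measurable_fun setT l,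
    (forall t, power_itv (q t)), (forall t, unit_itv (l t)) &
    let R1 := integ 0 T (fun t => rate1 (hfh T V xI xF tI tF t) (q t) (l t)) in
    let R2 := integ 0 T (fun t => rate2 (hfh T V xI xF tI tF t) (q t) (l t)) in
    [/\ a1 * R2 = a2 * R1, 0 < (1 - s) * R1 + s * R2 &
      forall x, xl <= x <= xr ->
        (T - (xr - xl) / V) * value s x + V^-1 * integ xl xr (value s) <=
        (1 - s) * R1 + s * R2]].
Proof.
have [s [y [qy [ly [z [qz [lz [sU my mz yz bal]]]]]]]] := balanced_endpoints.
exists s; split => //.
have [yI qyP lyU ymax] := my; have [zI qzP lzU zmax] := mz.
pose d := (z - y) / V.
have d0 : 0 <= d by rewrite divr_ge0 ?subr_ge0// ltW.
have Vd : V * d = z - y by rewrite /d mulrC divfK// gt_eqF.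
pose X (t : R) : R := y + V * clamp d t.
(* The hovering phases use the parameters of the two maximizers, the flight the explicit optimum, so
   the weighted rate is always [value s (X t)]. For [y = z] this is time sharing between two rate
   pairs at one position. *)
pose q (t : R) : R := if t <= 0 then qy else if t < d then best_q s (X t) else qz.
pose l (t : R) : R := if t <= 0 then ly else if t < d then best_l s else lz.
have Xlip : lip V X.
  move=> u t; rewrite /X opprD addrACA subrr add0r -mulrBr normrM gtr0_norm//.
  by rewrite ler_wpM2l ?(ltW V0)// (le_trans (clamp_lip d0 u t))// mul1r.
have mX : measurable_fun setT X by exact: lip_measurable Xlip.
have mq : measurable_fun setT q.
  apply: measurable_fun_ifT => //; first exact: measurable_fun_ler.
  apply: measurable_fun_ifT => //; first exact: measurable_fun_ltr.
  by apply: (measurableT_comp _ mX); exact: measurable_best_q.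
have ml : measurable_fun setT l.
  apply: measurable_fun_ifT => //; first exact: measurable_fun_ler.
  by apply: measurable_fun_ifT => //; exact: measurable_fun_ltr.
have qP t : power_itv (q t).
  by rewrite /q; do 2 (case: ifP => // _); exact: best_q_itv.
have lU t : unit_itv (l t).
  by rewrite /l; do 2 (case: ifP => // _); exact: best_l_itv.
have Xy t : t <= 0 -> X t = y by move=> t0; rewrite /X clamp_le0// mulr0 addr0.
have Xz t : d <= t -> X t = z by move=> dt; rewrite /X clamp_ge// Vd addrC subrK.
have Xyz t : y <= X t <= z.
  have /andP[c0 cd] := clamp_itv t d0.
  rewrite /X lerDl mulr_ge0 ?(ltW V0)//= -lerBrDl -Vd ler_wpM2l// ltW//.
have XI t : xl <= X t <= xr.
  have /andP[a b] := Xyz t; case/andP: yI => yl _; case/andP: zI => _ zr.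
  by rewrite (le_trans yl a) (le_trans b zr).
have wX t : wrate s (X t) (q t) (l t) = value s (X t).
  rewrite /q /l; case: ifPn => [t0|_]; first by rewrite Xy//; exact: maximizer_value.
  case: ifPn => //; rewrite -leNgt => dt; rewrite Xz//; exact: maximizer_value.
pose r1 t := rate1 (X t) (q t) (l t).
pose r2 t := rate2 (X t) (q t) (l t).
have [mr1 mr2] := measurable_rates measurableT mX mq ml.
have br1 t : `|r1 t| <= P * G by exact: rate1_bound.
have br2 t : `|r2 t| <= P * G by exact: rate2_bound.
have ir1 a b : integrable_on a b r1.
  by apply: (@bounded_integrable_on _ _ _ (P * G)) => //; exact: measurable_funTS.
have ir2 a b : integrable_on a b r2.
  by apply: (@bounded_integrable_on _ _ _ (P * G)) => //; exact: measurable_funTS.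
(* The margin 1 here and in [d + 1] puts the first and the last window strictly inside a hovering
   phase, even when [d = 0]. *)
pose A := - T - 1.
pose F1 t := integ A t r1.
pose F2 t := integ A t r2.
have PG0 : 0 <= P * G by rewrite (le_trans _ (br1 0)).
have lF1 : lip (P * G) F1 by exact: bounded_int_lip mr1 br1.
have lF2 : lip (P * G) F2 by exact: bounded_int_lip mr2 br2.
have cshift F : lip (P * G) F -> continuous (fun w : R => F (w + T) - F w).
  move=> FL w; apply: cvgB; last exact: lip_continuous FL w.
  apply: (@lip_continuous _ (P * G) (fun w => F (w + T))) => u t.
  by rewrite (le_trans (FL _ _))// opprD addrACA subrr addr0.
(* Imbalance accumulated over the window that starts at [w]. At [A] and at [d + 1] it is [T] times
   the imbalance of a maximizer, which gives the signs for the intermediate value theorem. *)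
pose N w := a1 * (F2 (w + T) - F2 w) - a2 * (F1 (w + T) - F1 w).
have cN : continuous N.
  move=> w; apply: cvgB; apply: cvgM; try exact: cvg_cst.
    exact: cshift lF2 w.
  exact: cshift lF1 w.
have NE w : A <= w -> F1 (w + T) - F1 w = integ w (w + T) r1 /\
    F2 (w + T) - F2 w = integ w (w + T) r2.
  move=> Aw; have wT : w <= w + T by rewrite lerDl ltW.
  rewrite /F1 /F2 (integ_split Aw wT (ir1 _ _)) (integ_split Aw wT (ir2 _ _)).
  by split; rewrite addrAC subrr add0r.
have NA : N A = T * imbalance a1 a2 y qy ly.
  have [E1 E2] := NE A (lexx A).
  have e t : A <= t <= A + T -> t <= 0 by rewrite /A; lra.
  rewrite /N E1 E2.
  rewrite (@eq_integ _ _ _ r1 (fun=> rate1 y qy ly)); last first.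
    by move=> t /e t0; rewrite /r1 /q /l t0 Xy.
  rewrite (@eq_integ _ _ _ r2 (fun=> rate2 y qy ly)); last first.
    by move=> t /e t0; rewrite /r2 /q /l t0 Xy.
  by rewrite !integ_cst ?lerDl ?ltW// /imbalance; ring.
have Ad : A <= d + 1 by rewrite /A; have := T0; have := d0; lra.
have Nd : N (d + 1) = T * imbalance a1 a2 z qz lz.
  have [E1 E2] := NE (d + 1) Ad.
  have e t : d + 1 <= t <= d + 1 + T -> [/\ (t <= 0) = false, (t < d) = false & d <= t].
    move=> /andP[dt _]; have d0' := d0.
    by split; [apply/negbTE; rewrite -ltNge|apply/negbTE; rewrite -leNgt|]; lra.
  rewrite /N E1 E2.
  rewrite (@eq_integ _ _ _ r1 (fun=> rate1 z qz lz)); last first.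
    by move=> t /e[t0 td dt]; rewrite /r1 /q /l t0 td Xz.
  rewrite (@eq_integ _ _ _ r2 (fun=> rate2 z qz lz)); last first.
    by move=> t /e[t0 td dt]; rewrite /r2 /q /l t0 td Xz.
  by rewrite !integ_cst ?lerDl ?ltW// /imbalance; ring.
have [w] : exists2 w, w \in `[A, d + 1] & N w = 0.
  apply: IVT => //; first exact: continuous_subspaceT.
  rewrite NA Nd ge_min le_max.
  case: bal => /andP[b1 b2].
    by rewrite (mulr_ge0_le0 (ltW T0) b1) (mulr_ge0 (ltW T0) b2) orbT.
  by rewrite (mulr_ge0_le0 (ltW T0) b1) (mulr_ge0 (ltW T0) b2) orbT.
rewrite in_itv/= => /andP[Aw wd] Nw.
have [E1 E2] := NE w Aw.
have [tI [tF [tI0 tF0 tIF hfhE]]] := hfh_window V w T0 d0.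
have hfhX (t : R) : 0 <= t <= T -> hfh T V (X w) (X (w + T)) tI tF t = X (w + t).
  exact: hfhE.
exists (X w), (X (w + T)), tI, tF; split.
  have /andP[xw _] := XI w; have /andP[_ xw'] := XI (w + T).
  split => //.
    by rewrite lerD2l ler_wpM2l ?(ltW V0)// clamp_le// lerDl ltW.
  split => //; rewrite -[RHS]tIF /X; field; exact: lt0r_neq0.
split.
  move=> u t uT tT; rewrite !hfhX// (le_trans (Xlip _ _))//.
  by rewrite opprD addrACA subrr add0r.
exists (fun t => q (w + t)), (fun t => l (w + t)).
have mw : measurable_fun setT (fun t : R => w + t) by exact: measurable_funD.
split => //; [exact: (measurableT_comp mq mw)|exact: (measurableT_comp ml mw)|].
have wint (f : R -> R) C : measurable_fun setT f -> (forall t, `|f t| <= C) ->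
    integ w (w + T) f = integ 0 T (fun t => f (w + t)).
  by move=> mf fC; rewrite -{1}[w]addr0; exact: integ_shift mf fC.
set R1 := integ 0 T (fun t => rate1 _ _ _).
set R2 := integ 0 T (fun t => rate2 _ _ _).
have R1E : R1 = integ w (w + T) r1.
  by rewrite (wint r1 (P * G))//; apply: eq_integ => t tT; rewrite hfhX.
have R2E : R2 = integ w (w + T) r2.
  by rewrite (wint r2 (P * G))//; apply: eq_integ => t tT; rewrite hfhX.
have wwT : w <= w + T by rewrite lerDl ltW.
have WE : (1 - s) * R1 + s * R2 = integ w (w + T) (value s \o X).
  rewrite R1E R2E -!integZ// -integD; [|exact: integrable_onZ..].
  by apply: eq_integ => t _; rewrite /= -wX.
have vL := value_lip sU.
have PK0 : 0 <= 3 * (P * K) by rewrite mulr_ge0// mulr_ge0// ltW.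
have vXL := lip_comp PK0 vL Xlip.
have ivX a b : integrable_on a b (value s \o X).
  by apply: continuous_integrable_on; exact: lip_continuous vXL.
split.
- by move: Nw; rewrite /N E1 E2 -R1E -R2E => /eqP; rewrite subr_eq0 => /eqP.
- have [x _ xmin] : exists2 x, x \in `[xl, xr] &
      forall t, t \in `[xl, xr] -> value s x <= value s t.
    by apply: EVT_min => //; apply: continuous_subspaceT; exact: lip_continuous vL.
  rewrite WE; apply: (@lt_le_trans _ _ (value s x * T)).
    by rewrite mulr_gt0// value_gt0.
  rewrite (_ : value s x * T = value s x * (w + T - w)); last by ring.
  rewrite -integ_cst//; apply: integ_le => //; first exact: integrable_on_cst.
  by move=> t _; apply: xmin; rewrite in_itv/=; exact: XI.
move=> x xI.
set M := value s y.
have Mmax u : xl <= u <= xr -> value s u <= M.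
  by move=> uI; rewrite /M -(maximizer_value sU my); exact: ymax.
have zM : value s z = M.
  apply/eqP; rewrite eq_le Mmax//= -(maximizer_value sU mz); exact: zmax.
(* Loss of weighted rate against hovering at a maximizer; it vanishes at [y] and at [z]. *)
pose psi u := M + (- 1) * value s u.
have psiL : lip (3 * (P * K)) psi.
  move=> u t; rewrite /psi opprD addrACA subrr add0r !mulN1r -opprD normrN.
  exact: vL.
have psi0 u : xl <= u <= xr -> 0 <= psi u.
  by move=> uI; rewrite /psi mulN1r subr_ge0 Mmax.
have ipsi a b : integrable_on a b psi.
  by apply: continuous_integrable_on; exact: lip_continuous psiL.
have ipX a b : integrable_on a b (psi \o X).
  by apply: continuous_integrable_on; exact: lip_continuous (lip_comp PK0 psiL Xlip).
have int_ge0 a b (f : R -> R) : (forall t, a <= t <= b -> 0 <= f t) -> 0 <= integ a b f.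
  by move=> f0; apply: Rintegral_ge0 => t /=; rewrite in_itv/=; exact: f0.
(* As [psi] is nonnegative, the window can be enlarged to [[A, d + 1 + T]]. There only the flight
   contributes, and its cost is the integral of [psi] over [[y, z]], a part of [[xl, xr]]. *)
have loss : V * integ w (w + T) (psi \o X) <= integ xl xr psi.
  have B : w + T <= d + 1 + T by rewrite lerD2r.
  have A0 : A <= 0 by rewrite /A; have := T0; lra.
  have dB : d <= d + 1 + T by have := T0; lra.
  have le1 : integ w (w + T) (psi \o X) <= integ A (d + 1 + T) (psi \o X).
    rewrite (integ_split Aw (le_trans wwT B))// (integ_split wwT B)//.
    rewrite addrCA lerDl addr_ge0//; apply: int_ge0 => t _; exact: psi0.
  have e2 : integ A (d + 1 + T) (psi \o X) = integ 0 d (psi \o X).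
    rewrite (integ_split A0 (le_trans d0 dB))// (integ_split d0 dB)//.
    rewrite (@eq_integ _ A 0 _ (fun=> 0)); last first.
      by move=> t /andP[_ t0]; rewrite /= Xy// /psi mulN1r subrr.
    rewrite (@eq_integ _ d _ _ (fun=> 0)); last first.
      by move=> t /andP[dt _]; rewrite /= Xz// /psi mulN1r zM subrr.
    by rewrite !integ_cst// !mul0r add0r addr0.
  have e3 : V * integ 0 d (psi \o X) = integ y z psi.
    have := @uniform_flight_cost _ _ _ PK0 psiL V y 0 d (ltW V0) d0.
    rewrite add0r Vd (addrC y) subrK => <-; congr (_ * _).
    by apply: eq_integ => t td; rewrite /= /X clamp_id// subr0.
  have le4 : integ y z psi <= integ xl xr psi.
    case/andP: yI => yl _; case/andP: zI => _ zr.
    rewrite (integ_split yl (le_trans yz zr))// (integ_split yz zr)//.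
    rewrite addrCA lerDl addr_ge0//; apply: int_ge0 => t /andP[a b]; apply: psi0.
      by rewrite a (le_trans b)// (le_trans yz).
    by rewrite b (le_trans _ a)// (le_trans yl).
  by apply: le_trans le4; rewrite -e3 -e2 ler_wpM2l ?(ltW V0).
have e5 : integ w (w + T) (psi \o X) = M * T - ((1 - s) * R1 + s * R2).
  rewrite WE /psi /= integD; [|exact: integrable_on_cst|exact: integrable_onZ].
  by rewrite integ_cst// integZ// mulN1r addrAC subrr add0r.
have e6 : integ xl xr psi = M * (xr - xl) - integ xl xr (value s).
  have iv : integrable_on xl xr (value s).
    by apply: continuous_integrable_on; exact: lip_continuous vL.
  rewrite /psi integD ?integ_cst ?integZ ?mulN1r//.
    exact: integrable_on_cst.
  exact: integrable_onZ.
have TV : 0 <= T - (xr - xl) / V by rewrite subr_ge0 ler_pdivrMr// mulrC.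
apply: le_trans (lerD (ler_wpM2l TV (Mmax x xI)) (lexx _)) _.
move: loss; rewrite e5 e6 mulrC -ler_pdivlMr// => loss.
rewrite -subr_ge0; move: loss; rewrite -subr_ge0; congr (0 <= _); ring.
Qed.

End window.

(** * Upper bounds for arbitrary trajectories *)

Lemma value_bound s x : unit_itv s -> `|value s x| <= P * G.
Proof.
move=> sU; have qP := best_q_itv x sU; have lU := best_l_itv s.
have v0 := value_gt0 x sU; rewrite (ger0_norm (ltW v0)).
have /andP[s0 s1] := sU.
have /ler_normlW b1 := rate1_bound x qP lU.
have /ler_normlW b2 := rate2_bound x qP lU.
rewrite (_ : P * G = (1 - s) * (P * G) + s * (P * G)); last by ring.
by rewrite /value /wrate; apply: lerD; apply: ler_wpM2l => //; rewrite subr_ge0.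
Qed.

(** The left side combines the sum constraint with the constraint of the user of larger weight, as
    in [(1 - s) r1 + s r2 = s (r1 + r2) + (1 - 2 s) r1]. Unspent power goes to the other user, and
    moving to [x'] lowers no gain. *)
Lemma rate_le_value s x x' p1 p2 : unit_itv s -> 0 <= p1 -> 0 <= p2 ->
  p1 + p2 <= P -> g1 x <= g1 x' -> g2 x <= g2 x' ->
  (if s <= 2^-1
   then s * ln (1 + p1 * g1 x + p2 * g2 x) + (1 - 2 * s) * ln (1 + p1 * g1 x)
   else (1 - s) * ln (1 + p1 * g1 x + p2 * g2 x) +
        (2 * s - 1) * ln (1 + p2 * g2 x)) <= value s x'.
Proof.
move=> sU p10 p20 pP h1 h2; have /andP[s0 s1] := sU.
have a1 := ler_wpM2l p10 h1.
have a2 := ler_wpM2l p20 h2.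
have b1 := mulr_ge0 p10 (ltW (g1_gt0 x)).
have b2 := mulr_ge0 p20 (ltW (g2_gt0 x)).
have mono u v : 0 <= u -> u <= v -> ln (1 + u) <= ln (1 + v).
  by move=> u0 uv; rewrite ler_ln ?posrE; lra.
case: ifPn => s2.
  have qP : power_itv p1 by rewrite /power_itv p10/=; lra.
  have lU : unit_itv (0 : R) by rewrite /unit_itv lexx ler01.
  apply: le_trans (wrate_le_value x' sU qP lU).
  have c2 : p2 * g2 x' <= (P - p1) * g2 x'.
    by rewrite ler_wpM2r ?(ltW (g2_gt0 x'))//; lra.
  have -> : wrate s x' p1 0 = s * C12 x' p1 + (1 - 2 * s) * C1 x' p1.
    by rewrite /wrate /rate1 /rate2; ring.
  apply: lerD; apply: ler_wpM2l => //; [|lra|exact: mono].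
  by rewrite /C12 -!addrA; apply: mono; lra.
have qP : power_itv (P - p2) by rewrite /power_itv; apply/andP; split; lra.
have lU : unit_itv (1 : R) by rewrite /unit_itv lexx ler01.
rewrite -ltNge in s2.
apply: le_trans (wrate_le_value x' sU qP lU).
have c1 : p1 * g1 x' <= (P - p2) * g1 x'.
  by rewrite ler_wpM2r ?(ltW (g1_gt0 x'))//; lra.
have PP : P - (P - p2) = p2 by ring.
have -> : wrate s x' (P - p2) 1 =
    (1 - s) * C12 x' (P - p2) + (2 * s - 1) * C2 x' (P - p2).
  by rewrite /wrate /rate1 /rate2; ring.
rewrite /C12 /C2 PP; apply: lerD; apply: ler_wpM2l; [lra| |lra|exact: mono].
by rewrite -!addrA; apply: mono; lra.
Qed.

Section upper_bound.
Variables (T V lo hi : R).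
Hypotheses (T0 : 0 < T) (V0 : 0 < V).

(* [xl, xr] is the range of a trajectory: every point of it is crossed at speed
   at most [V], and the remaining time is spent at best at a maximizer. *)
Definition range_bound xl xr (c : R -> R) :=
  [/\ lo <= xl, xl <= xr, xr <= hi, xr - xl <= V * T &
  forall s, unit_itv s -> exists2 x, xl <= x <= xr &
    c s <= (T - (xr - xl) / V) * value s x + V^-1 * integ xl xr (value s)].

(** Against hovering at the maximizer [m] the trajectory loses at rate [psi >= 0]. Between the times
    of its minimum and its maximum, [travel_cost] makes this loss at least the integral of [psi]
    over the range divided by [V]. *)
Lemma trajectory_range (x : R -> R) : lip V x -> (forall t, lo <= x t <= hi) ->
  exists xl xr, range_bound xl xr (fun s => integ 0 T (value s \o x)).
Proof.
move=> xV xlh.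
have cx : {within `[0, T], continuous x}.
  by apply: continuous_subspaceT; exact: lip_continuous xV.
have [t0 + mint] := EVT_min (ltW T0) cx.
have [t1 + maxt] := EVT_max (ltW T0) cx.
rewrite !in_itv/= => t1T t0T.
exists (x t0), (x t1).
have xI t : 0 <= t <= T -> x t0 <= x t <= x t1.
  by move=> tT; rewrite mint ?maxt ?in_itv.
have x01 : x t0 <= x t1 by have /andP[] := xI t1 t1T.
have dt : `|t1 - t0| <= T.
  by move: t1T t0T => /andP[? ?] /andP[? ?]; rewrite ler_norml; apply/andP; split; lra.
split => //.
- by have /andP[] := xlh t0.
- by have /andP[] := xlh t1.
- rewrite -[leLHS]ger0_norm ?subr_ge0// (le_trans (xV _ _))// ler_wpM2l// ltW//.
move=> s sU; have vL := value_lip sU.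
have PK0 : 0 <= 3 * (P * K) by rewrite mulr_ge0// mulr_ge0// ltW.
have [m mI mmax] := value_argmax x01 sU.
exists m => //; set M := value s m.
pose psi u := M + (- 1) * value s u.
have psiL : lip (3 * (P * K)) psi.
  move=> u t; rewrite /psi opprD addrACA subrr add0r !mulN1r -opprD normrN.
  exact: vL.
have ipX a b : integrable_on a b (psi \o x).
  by apply: continuous_integrable_on; exact: lip_continuous (lip_comp PK0 psiL xV).
have ivX a b : integrable_on a b (value s \o x).
  by apply: continuous_integrable_on; exact: lip_continuous (lip_comp PK0 vL xV).
have psi0 t : 0 <= t <= T -> 0 <= psi (x t).
  by move=> tT; rewrite /psi mulN1r subr_ge0 mmax// xI.
have e5 : integ 0 T (psi \o x) = M * T - integ 0 T (value s \o x).
  rewrite /psi /= integD; [|exact: integrable_on_cst|exact: integrable_onZ].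
  by rewrite integ_cst ?(ltW T0)// subr0 integZ// mulN1r.
have e6 : integ (x t0) (x t1) psi = M * (x t1 - x t0) - integ (x t0) (x t1) (value s).
  have iv : integrable_on (x t0) (x t1) (value s).
    by apply: continuous_integrable_on; exact: lip_continuous vL.
  rewrite /psi integD ?integ_cst ?integZ ?mulN1r//.
    exact: integrable_on_cst.
  exact: integrable_onZ.
have int_ge0 a b : 0 <= a -> b <= T -> 0 <= integ a b (psi \o x).
  move=> a0 bT; apply: Rintegral_ge0 => t /=; rewrite in_itv/= => /andP[at_ tb].
  by apply: psi0; rewrite (le_trans a0)// (le_trans tb).
have part a b : 0 <= a -> a <= b -> b <= T ->
    integ a b (psi \o x) <= integ 0 T (psi \o x).
  move=> a0 ab bT; rewrite (integ_split a0 (le_trans ab bT))// (integ_split ab bT)//.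
  rewrite addrCA lerDl; apply: addr_ge0; apply: int_ge0 => //.
    exact: le_trans ab bT.
  exact: le_trans a0 ab.
have cost : integ (x t0) (x t1) psi <= V * integ 0 T (psi \o x).
  have /andP[t00 t0T'] := t0T; have /andP[t10 t1T'] := t1T.
  have travel a b : 0 <= a -> a <= b -> b <= T ->
      `|integ (x t0) (x b) psi - integ (x t0) (x a) psi| <= V * integ a b (psi \o x).
    move=> a0 ab bT; have sub t : a <= t <= b -> 0 <= t <= T.
      by move=> /andP[a1 b1]; rewrite (le_trans a0)// (le_trans b1).
    apply: (@travel_cost _ psi _ PK0 psiL _ V x a b ab (ltW V0) xV).
      by move=> t /sub/xI/andP[].
    by move=> t /sub/psi0.
  have [t01|/ltW t10'] := leP t0 t1.
    have := travel t0 t1 t00 t01 t1T'; rewrite integ_itv0 subr0.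
    move=> /(le_trans (ler_norm _)) /le_trans; apply.
    by rewrite ler_wpM2l ?(ltW V0)// part.
  have := travel t1 t0 t10 t10' t0T'; rewrite integ_itv0 sub0r normrN.
  move=> /(le_trans (ler_norm _)) /le_trans; apply.
  by rewrite ler_wpM2l ?(ltW V0)// part.
move: cost; rewrite e5 e6 [X in _ <= X]mulrC -ler_pdivrMr// => cost.
rewrite -subr_ge0; move: cost; rewrite -subr_ge0; congr (0 <= _); ring.
Qed.

(** The endpoints stay in the compact [[lo, hi]] and converge along one ultrafilter, chosen before
    the weight; for each weight the positions [x] converge along it as well. *)
Lemma range_bound_closed (r_ : nat -> R) (r : R) (c : R -> R) : r_ @ \oo --> r ->
  (forall n, exists xl xr, range_bound xl xr (fun s => r_ n * c s)) ->
  exists xl xr, range_bound xl xr (fun s => r * c s).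
Proof.
move=> rr H.
have [U [UU oU]] := @ultraFilterLemma nat \oo _.
have {}rr : r_ @ U --> r by apply: cvg_trans rr => A /oU.
have [xl_ {}H] := choice H; have [xr_ {}H] := choice H.
have [xl xlI xlc] : exists2 x : R, lo <= x <= hi & xl_ @ U --> x.
  apply: ultra_lim => n; have [a b d _ _] := H n.
  by rewrite a (le_trans b).
have [xr xrI xrc] : exists2 x : R, lo <= x <= hi & xr_ @ U --> x.
  apply: ultra_lim => n; have [a b d _ _] := H n.
  by rewrite d (le_trans a).
have lim_le (f g : nat -> R) a b : f @ U --> a -> g @ U --> b ->
    (forall n, f n <= g n) -> a <= b.
  by move=> fa gb fg; apply: (ler_cvg_to fa gb); exact: filterE.
have dc : (fun n => xr_ n - xl_ n) @ U --> xr - xl by exact: cvgB.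
exists xl, xr; split.
- by case/andP: xlI.
- by apply: (lim_le _ _ _ _ xlc xrc) => n; case: (H n).
- by case/andP: xrI.
- by apply: (cvgr_to_le dc); apply: filterE => n; case: (H n).
move=> s sU.
have exm n : exists x, xl_ n <= x <= xr_ n /\ r_ n * c s <=
    (T - (xr_ n - xl_ n) / V) * value s x + V^-1 * integ (xl_ n) (xr_ n) (value s).
  by have [_ _ _ _ /(_ s sU)[x xI xb]] := H n; exists x.
have [m_ mP] := choice exm.
have [m mI mc] : exists2 x : R, lo <= x <= hi & m_ @ U --> x.
  apply: ultra_lim => n; have [a b d _ _] := H n.
  by have [/andP[e f] _] := mP n; rewrite (le_trans a e) (le_trans f d).
exists m.
  apply/andP; split.
    by apply: (lim_le _ _ _ _ xlc mc) => n; case: (mP n) => /andP[].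
  by apply: (lim_le _ _ _ _ mc xrc) => n; case: (mP n) => /andP[].
have vL := value_lip sU.
have PG0 : 0 <= P * G by rewrite (le_trans _ (value_bound lo sU)).
have FL : lip (P * G) (fun t => integ lo t (value s)).
  apply: bounded_int_lip => //; last by move=> t; exact: value_bound.
  exact: lip_measurable vL.
have iv a b : integrable_on a b (value s).
  by apply: continuous_integrable_on; exact: lip_continuous vL.
(* With both endpoints moving, the integral becomes a difference of antiderivatives from [lo], each
   continuous in its endpoint. *)
have FE a b : lo <= a -> a <= b ->
    integ a b (value s) = integ lo b (value s) - integ lo a (value s).
  by move=> la ab; rewrite (integ_split la ab)// addrAC subrr add0r.
have vm : (fun n => value s (m_ n)) @ U --> value s m.
  exact: (cvg_comp _ _ mc (@lip_continuous _ _ _ vL m)).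
have Fl : (fun n => integ lo (xl_ n) (value s)) @ U --> integ lo xl (value s).
  exact: (cvg_comp _ _ xlc (@lip_continuous _ _ _ FL xl)).
have Fr : (fun n => integ lo (xr_ n) (value s)) @ U --> integ lo xr (value s).
  exact: (cvg_comp _ _ xrc (@lip_continuous _ _ _ FL xr)).
have xlr : xl <= xr by apply: (lim_le _ _ _ _ xlc xrc) => n; case: (H n).
rewrite FE//; last by case/andP: xlI.
have L1 : (fun n => r_ n * c s) @ U --> r * c s.
  by apply: cvgM => //; exact: cvg_cst.
have L2 : (fun n => T - (xr_ n - xl_ n) / V) @ U --> T - (xr - xl) / V.
  apply: cvgB; first exact: cvg_cst.
  by apply: cvgM => //; exact: cvg_cst.
have L3 : (fun n => V^-1 * (integ lo (xr_ n) (value s) - integ lo (xl_ n) (value s)))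
    @ U --> V^-1 * (integ lo xr (value s) - integ lo xl (value s)).
  by apply: cvgM; [exact: cvg_cst|exact: cvgB].
apply: (lim_le _ _ _ _ L1 (cvgD (cvgM L2 vm) L3)) => n.
have [_] := mP n; have [a b _ _ _] := H n.
by rewrite FE.
Qed.

End upper_bound.

(** * Capacity constraints and weighted rates *)

Lemma capacity_integrable_on (T : R) (x p1 p2 : R -> R) :
  measurable_fun `[0, T] x -> measurable_fun `[0, T] p1 ->
  measurable_fun `[0, T] p2 ->
  (forall t, 0 <= t <= T -> [/\ 0 <= p1 t, 0 <= p2 t & p1 t + p2 t <= P]) ->
  [/\ integrable_on 0 T (fun t => ln (1 + p1 t * g1 (x t))),
      integrable_on 0 T (fun t => ln (1 + p2 t * g2 (x t))) &
      integrable_on 0 T (fun t => ln (1 + p1 t * g1 (x t) + p2 t * g2 (x t)))].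
Proof.
move=> mx mp1 mp2 pP.
have m1 : measurable_fun `[0, T] (fun t => p1 t * g1 (x t)).
  apply: measurable_funM => //.
  by apply: (measurableT_comp _ mx); exact: lip_measurable g1K.
have m2 : measurable_fun `[0, T] (fun t => p2 t * g2 (x t)).
  apply: measurable_funM => //.
  by apply: (measurableT_comp _ mx); exact: lip_measurable g2K.
have m11 : measurable_fun `[0, T] (fun t => 1 + p1 t * g1 (x t)).
  exact: measurable_funD.
have m12 : measurable_fun `[0, T] (fun t => 1 + p2 t * g2 (x t)).
  exact: measurable_funD.
have m3 : measurable_fun `[0, T] (fun t => 1 + p1 t * g1 (x t) + p2 t * g2 (x t)).
  exact: measurable_funD.
have bnd t : 0 <= t <= T -> [/\ 0 <= p1 t * g1 (x t), 0 <= p2 t * g2 (x t) &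
    p1 t * g1 (x t) + p2 t * g2 (x t) <= P * G].
  move=> /pP[a b c]; have g10 := g1_gt0 (x t); have g20 := g2_gt0 (x t).
  split; [by rewrite mulr_ge0// ltW|by rewrite mulr_ge0// ltW|].
  have G0 : 0 <= G := le_trans (ltW g10) (g1G (x t)).
  apply: le_trans (lerD (ler_wpM2l a (g1G _)) (ler_wpM2l b (g2G _))) _.
  by rewrite -mulrDl ler_wpM2r.
have lnb u : 0 <= u -> u <= P * G -> `|ln (1 + u)| <= P * G.
  move=> u0 uPG; rewrite ger0_norm ?ln_ge0 ?lerDl// (le_trans (le_ln1Dx _))//.
  by rewrite (lt_le_trans _ u0)// ltrN10.
split.
- apply: (@bounded_integrable_on _ _ _ (P * G)); first exact: measurableT_comp.
  by move=> t /bnd[a b c]; apply: lnb => //; rewrite (le_trans _ c)// lerDl.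
- apply: (@bounded_integrable_on _ _ _ (P * G)); first exact: measurableT_comp.
  by move=> t /bnd[a b c]; apply: lnb => //; rewrite (le_trans _ c)// lerDr.
- apply: (@bounded_integrable_on _ _ _ (P * G)); first exact: measurableT_comp.
  by move=> t /bnd[a b c]; rewrite -addrA; apply: lnb => //; rewrite addr_ge0.
Qed.

Lemma capacity_le_value s (T V : R) (x x' p1 p2 : R -> R) (c1 c2 : R) : unit_itv s ->
  measurable_fun `[0, T] x -> measurable_fun `[0, T] p1 ->
  measurable_fun `[0, T] p2 ->
  (forall t, 0 <= t <= T -> [/\ 0 <= p1 t, 0 <= p2 t & p1 t + p2 t <= P]) ->
  (forall t, 0 <= t <= T -> g1 (x t) <= g1 (x' t) /\ g2 (x t) <= g2 (x' t)) ->
  lip V x' ->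
  c1 <= integ 0 T (fun t => ln (1 + p1 t * g1 (x t))) ->
  c2 <= integ 0 T (fun t => ln (1 + p2 t * g2 (x t))) ->
  c1 + c2 <= integ 0 T (fun t => ln (1 + p1 t * g1 (x t) + p2 t * g2 (x t))) ->
  (1 - s) * c1 + s * c2 <= integ 0 T (value s \o x').
Proof.
move=> sU mx mp1 mp2 pP gx x'V h1 h2 h12.
have [i1 i2 i12] := capacity_integrable_on mx mp1 mp2 pP.
have PK0 : 0 <= 3 * (P * K) by rewrite mulr_ge0// mulr_ge0// ltW.
have iv : integrable_on 0 T (value s \o x').
  by apply: continuous_integrable_on; exact: lip_continuous (lip_comp PK0 (value_lip sU) x'V).
have pt t (tT : 0 <= t <= T) := let: And3 a b c := pP t tT in
  rate_le_value sU a b c (gx t tT).1 (gx t tT).2.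
have /andP[s0 s1] := sU.
move: pt; case: (leP s 2^-1) => s2 pt.
  have s3 : 0 <= 1 - 2 * s by lra.
  rewrite (_ : _ + _ = s * (c1 + c2) + (1 - 2 * s) * c1); last by ring.
  apply: le_trans (lerD (ler_wpM2l s0 h12) (ler_wpM2l s3 h1)) _.
  rewrite -!integZ// -integD; [|exact: integrable_onZ..].
  by apply: integ_le => //; apply: integrable_onD; exact: integrable_onZ.
have s3 : 0 <= 2 * s - 1 by lra.
have s4 : 0 <= 1 - s by lra.
rewrite (_ : _ + _ = (1 - s) * (c1 + c2) + (2 * s - 1) * c2); last by ring.
apply: le_trans (lerD (ler_wpM2l s4 h12) (ler_wpM2l s3 h2)) _.
rewrite -!integZ// -integD; [|exact: integrable_onZ..].
by apply: integ_le => //; apply: integrable_onD; exact: integrable_onZ.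
Qed.

Lemma range_bound_le T V lo hi xl xr (c c' : R -> R) :
  (forall s, unit_itv s -> c' s <= c s) ->
  range_bound T V lo hi xl xr c -> range_bound T V lo hi xl xr c'.
Proof.
move=> cc [h1 h2 h3 h4 h5]; split => // s sU.
by have [x xI xb] := h5 s sU; exists x => //; rewrite (le_trans (cc s sU)).
Qed.

(** For finiteness of the supremum: hovering and crossing together last [T], at rates of at most
    [P * G]. *)
Lemma range_bound_le_max T V lo hi xl xr (c : R -> R) s : 0 < V -> unit_itv s ->
  range_bound T V lo hi xl xr c -> c s <= T * (P * G).
Proof.
move=> V0 sU [h1 h2 h3 h4 h5]; have [x xI xb] := h5 s sU.
have TV : 0 <= T - (xr - xl) / V by rewrite subr_ge0 ler_pdivrMr// mulrC.
have vb y : value s y <= P * G by apply: ler_normlW; exact: value_bound.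
have ib : integ xl xr (value s) <= P * G * (xr - xl).
  rewrite -integ_cst//; apply: integ_le => //; last exact: integrable_on_cst.
  by apply: continuous_integrable_on; exact: lip_continuous (value_lip sU).
have V1 : 0 <= V^-1 by rewrite invr_ge0 ltW.
apply: le_trans xb (le_trans (lerD (ler_wpM2l TV (vb x)) (ler_wpM2l V1 ib)) _).
by rewrite le_eqVlt; apply/orP; left; apply/eqP; ring.
Qed.

End broadcast.

(** * The channel gain *)

Section gain.
Variables (R : realType) (H beta0 : R).
Hypotheses (H0 : 0 < H) (beta0_gt0 : 0 < beta0).

Lemma gain_denom_gt0 u : 0 < u ^+ 2 + H ^+ 2.
Proof. by rewrite ltr_wpDl ?sqr_ge0// exprn_gt0. Qed.

Lemma gain_gt0 c x : 0 < gain beta0 H c x.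
Proof. by rewrite divr_gt0// gain_denom_gt0. Qed.

Lemma gain_mono c x y : (y - c) ^+ 2 <= (x - c) ^+ 2 ->
  gain beta0 H c x <= gain beta0 H c y.
Proof.
move=> yx; rewrite /gain ler_wpM2l ?(ltW beta0_gt0)// lef_pV2 ?posrE ?gain_denom_gt0//.
by rewrite lerD2r.
Qed.

Lemma gain_le c x : gain beta0 H c x <= gain beta0 H c c.
Proof. by apply: gain_mono; rewrite subrr expr0n sqr_ge0. Qed.

(* [|x + y| / ((x^2 + H^2) (y^2 + H^2)) <= 1 / H^3] by [2 H |x| <= x^2 + H^2]. *)
Lemma gain_lip c : lip (beta0 / H ^+ 3) (gain beta0 H c).
Proof.
move=> x y.
pose a := x - c; pose b := y - c.
pose A := a ^+ 2 + H ^+ 2; pose B := b ^+ 2 + H ^+ 2.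
have A0 : 0 < A by exact: gain_denom_gt0.
have B0 : 0 < B by exact: gain_denom_gt0.
have h2 : 0 < H ^+ 2 by rewrite exprn_gt0.
have amgm u : 2 * H * `|u| <= u ^+ 2 + H ^+ 2.
  rewrite -(real_normK (num_real u)) -subr_ge0.
  by rewrite (_ : _ - _ = (`|u| - H) ^+ 2) ?sqr_ge0//; ring.
have key : H ^+ 3 * `|a + b| <= A * B.
  apply: (@le_trans _ _ (H ^+ 2 * ((A + B) / 2))).
    rewrite exprSr -mulrA ler_wpM2l ?(ltW h2)//.
    rewrite ler_pdivlMr//.
    have := ler_wpM2l (ltW H0) (ler_normD a b); have := amgm a; have := amgm b.
    rewrite -/A -/B; lra.
  have HA : H ^+ 2 <= A by rewrite lerDr sqr_ge0.
  have HB : H ^+ 2 <= B by rewrite lerDr sqr_ge0.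
  have := ler_wpM2r (ltW A0) HB; have := ler_wpM2r (ltW B0) HA; lra.
have -> : gain beta0 H c x - gain beta0 H c y =
    beta0 * ((a + b) * (y - x)) / (A * B).
  rewrite /gain -/a -/b -/A -/B.
  have -> : (a + b) * (y - x) = B - A by rewrite /A /B /a /b; ring.
  by field; rewrite !gt_eqF.
rewrite !normrM normfV [`|A * B|]gtr0_norm ?mulr_gt0// gtr0_norm//.
rewrite ler_pdivrMr ?mulr_gt0// (distrC y).
rewrite -!mulrA ler_wpM2l ?(ltW beta0_gt0)// mulrA mulrC -mulrA.
rewrite mulrCA ler_wpM2l// mulrC ler_pdivlMr ?exprn_gt0// mulrC.
exact: key.
Qed.

End gain.

(** * Trajectories of bounded speed *)

Section speed.
Variable R : realType.
Implicit Types (T V : R) (x : R -> R).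

(** Freezing the trajectory outside [[0, T]] extends the speed bound to the whole line. *)
Lemma speed_ok_lip T V x : 0 <= T -> 0 <= V -> speed_ok T V x ->
  lip V (x \o clamp T).
Proof.
move=> T0 V0 xV s t; rewrite /= (le_trans (xV _ _ _ _)) ?clamp_itv//.
by rewrite ler_wpM2l// (le_trans (clamp_lip T0 _ _))// mul1r.
Qed.

Lemma speed_ok_measurable T V x : 0 <= T -> 0 <= V -> speed_ok T V x ->
  measurable_fun `[0, T] x.
Proof.
move=> T0 V0 xV; apply: (@eq_measurable_fun _ _ _ _ _ (x \o clamp T)).
  by move=> t; rewrite inE/= in_itv/= => tT; rewrite /= clamp_id.
by apply: measurable_funTS; exact: lip_measurable (speed_ok_lip T0 V0 xV).
Qed.

End speed.

(** Passes from averages in bits to integrals of natural logarithms, which explains the factor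
    [T * ln 2] below. *)
Lemma avg_log2 (R : realType) (T : R) (f : R -> R) :
  integrable_on 0 T (fun t => ln (f t)) ->
  avg T (fun t => log2 (f t)) = integ 0 T (fun t => ln (f t)) / (T * ln 2).
Proof.
move=> fi; rewrite /avg /log2 RintegralZr// -/(integ 0 T _) invfM; ring.
Qed.

(** * Attainment of the supremum *)

Section optimality.
Variables (R : realType) (D H beta0 Pbar T V a1 a2 : R).
Hypotheses (D0 : 0 < D) (H0 : 0 < H) (beta0_gt0 : 0 < beta0).
Hypotheses (P0 : 0 < Pbar) (T0 : 0 < T) (V0 : 0 < V).
Hypotheses (a10 : 0 <= a1) (a20 : 0 <= a2) (a12 : a1 + a2 = 1).

Let g1 := h1 D H beta0.
Let g2 := h2 D H beta0.
Let K := beta0 / H ^+ 3.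
Let G := gain beta0 H 0 0.

Let K0 : 0 <= K. Proof. by rewrite divr_ge0 ?exprn_ge0 ?ltW. Qed.
Let g1K : lip K g1. Proof. exact: gain_lip. Qed.
Let g2K : lip K g2. Proof. exact: gain_lip. Qed.
Let g1_gt0 x : 0 < g1 x. Proof. exact: gain_gt0. Qed.
Let g2_gt0 x : 0 < g2 x. Proof. exact: gain_gt0. Qed.
Let gainG c x : gain beta0 H c x <= G.
Proof. by rewrite (le_trans (gain_le _ _ c x))// /G /gain !subrr. Qed.
Let g1G x : g1 x <= G. Proof. exact: gainG. Qed.
Let g2G x : g2 x <= G. Proof. exact: gainG. Qed.

Let Tln2 : 0 < T * ln 2.
Proof. by rewrite mulr_gt0// ln_gt0// ltr1n. Qed.

(** Projection onto the segment between the users. It is 1-Lipschitz and brings the UAV no farther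
    from either user, so upper bounds may be proved for the projected trajectory. *)
Let proj u := - (D / 2) + clamp D (u + D / 2).

Let proj_itv u : - (D / 2) <= proj u <= D / 2.
Proof.
have /andP[a b] := clamp_itv (u + D / 2) (ltW D0).
by rewrite /proj; apply/andP; split; lra.
Qed.

Let proj_gain u : g1 u <= g1 (proj u) /\ g2 u <= g2 (proj u).
Proof.
have D0' := D0.
by split; apply: gain_mono => //; rewrite /proj;
  case: (clampP (u + D / 2) (ltW D0)) => -[? ->]; nra.
Qed.

(** If [r] is feasible, the weighted rate integrated in natural logarithms is at least
    [r * weight s]. *)
Let weight s := ((1 - s) * a1 + s * a2) * (T * ln 2).

Definition achievable r := exists r1 r2 x p1 p2,
  P1_feasible D H beta0 Pbar T V a1 a2 r r1 r2 x p1 p2.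

Lemma achievable_range r : achievable r -> exists xl xr,
  range_bound g1 g2 Pbar T V (- (D / 2)) (D / 2) xl xr (fun s => r * weight s).
Proof.
move=> [r1 [r2 [x [p1 [p2 [ar1 ar2 [r10 r20 c1 c2 c12] [mp1 mp2 pP] xV]]]]]].
pose x' := proj \o (x \o clamp T).
have xL := speed_ok_lip (ltW T0) (ltW V0) xV.
have mx := speed_ok_measurable (ltW T0) (ltW V0) xV.
have x'V : lip V x'.
  move=> s t; rewrite /x' /proj /= opprD addrACA subrr add0r.
  rewrite (le_trans (clamp_lip (ltW D0) _ _))// mul1r opprD addrACA subrr addr0.
  exact: xL.
have [xl [xr xlr]] := trajectory_range K0 P0 g1K g2K g1_gt0 g2_gt0 g1G g2G
  T0 V0 x'V (fun t => proj_itv _).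
exists xl, xr; apply: range_bound_le xlr => s sU.
have /andP[s0 s1] := sU.
have [i1 i2 i12] := capacity_integrable_on g1K g2K g1_gt0 g2_gt0 g1G g2G mx mp1 mp2 pP.
have gx t : 0 <= t <= T -> g1 (x t) <= g1 (x' t) /\ g2 (x t) <= g2 (x' t).
  by move=> tT; rewrite /x' /= clamp_id//; exact: proj_gain.
move: c1 c2 c12; rewrite !avg_log2// !ler_pdivlMr// => c1 c2 c12.
rewrite mulrDl in c12.
apply: le_trans (capacity_le_value K0 P0 g1K g2K g1_gt0 g2_gt0 g1G g2G
  sU mx mp1 mp2 pP gx x'V c1 c2 c12).
rewrite /weight mulrA !(mulrA _ _ (T * ln 2)) -mulrDl.
rewrite ler_wpM2r ?(ltW Tln2)//.
have s1' : 0 <= 1 - s by rewrite subr_ge0.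
have := ler_wpM2l s1' ar1; have := ler_wpM2l s0 ar2; lra.
Qed.

Lemma achievable0 : achievable 0.
Proof.
have log_ge0 (f : R -> R) : (forall t, 1 <= f t) -> 0 <= avg T (fun t => log2 (f t)).
  move=> f1; apply: mulr_ge0; first by rewrite invr_ge0 ltW.
  apply: Rintegral_ge0 => t _; rewrite divr_ge0 ?ln_ge0// ler1n//.
exists 0, 0, (fun=> 0), (fun=> 0), (fun=> 0); split.
- by rewrite mulr0.
- by rewrite mulr0.
- split => //; rewrite ?addr0; apply: log_ge0 => t; by rewrite !mul0r !addr0.
- by split => // t _; rewrite addr0 lexx (ltW P0).
- by move=> s t _ _; rewrite subrr normr0 mulr_ge0// ltW.
Qed.

Lemma achievable_bounded : has_sup achievable.
Proof.
split; first by exists 0; exact: achievable0.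
(* At [s = 1/2] the factor [(1 - s) a1 + s a2] is 1/2 for all shares, whence the 2 in the bound. *)
have hU : unit_itv (2^-1 : R) by rewrite /unit_itv invr_ge0 ler0n invf_le1// ler1n.
exists (2 * (T * (Pbar * G)) / (T * ln 2)) => r /achievable_range[xl [xr]].
move=> /(range_bound_le_max K0 P0 g1K g2K g1_gt0 g2_gt0 g1G g2G V0 hU).
rewrite ler_pdivlMr// /weight.
have -> : 1 - 2^-1 = 2^-1 :> R by field.
rewrite -mulrDr a12 mulr1; lra.
Qed.

(** Attainment is not yet known here: achievable values tending to the supremum have range bounds,
    and these pass to the limit. *)
Lemma sup_range : exists xl xr,
  range_bound g1 g2 Pbar T V (- (D / 2)) (D / 2) xl xr
    (fun s => sup achievable * weight s).
Proof.
have h0 n : 0 < n.+1%:R^-1 :> R by rewrite invr_gt0 ltr0n.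
have ex n : exists r, achievable r /\ sup achievable - n.+1%:R^-1 < r.
  by have [r Sr lt] := sup_adherent (h0 n) achievable_bounded; exists r.
have [r_ rP] := choice ex.
apply: (range_bound_closed K0 P0 g1K g2K g1_gt0 g2_gt0 g1G g2G (r_ := r_)).
  apply: (@squeeze_cvgr _ _ _ _ (fun n => sup achievable - n.+1%:R^-1)
    (fun=> sup achievable)).
  - apply: nearW => n; have [Sr lt] := rP n; rewrite (ltW lt)/=.
    by apply: ub_le_sup Sr; case: achievable_bounded.
  - rewrite -[X in _ --> X]subr0; apply: cvgB; first exact: cvg_cst.
    exact: cvg_harmonic.
  - exact: cvg_cst.
by move=> n; apply: achievable_range; case: (rP n).
Qed.

Lemma hfh_optimal : exists xI xF tI tF : R,
  [/\ - (D / 2) <= xI, xI <= xF, xF <= D / 2 &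
      [/\ 0 <= tI, 0 <= tF & tI + (xF - xI) / V + tF = T]] /\
  exists (r r1 r2 : R) (p1 p2 : R -> R),
    P1_optimal D H beta0 Pbar T V a1 a2 r r1 r2 (hfh T V xI xF tI tF) p1 p2.
Proof.
have [xl [xr [Dl xlr Dr xrV xb]]] := sup_range.
have [s [sU [xI [xF [tI [tF [geo [xV [q [l [mq ml qP lU]]]]]]]]]]] :=
  hfh_schedule K0 P0 g1K g2K g1_gt0 g2_gt0 g1G g2G T0 V0 xlr xrV a10 a20.
set x := hfh T V xI xF tI tF in xV *.
set R1 := integ 0 T _; set R2 := integ 0 T _; move=> [bal W0 Wb].
exists xI, xF, tI, tF; split.
  by case: geo => lI IF Fr ?; split=> //; [exact: le_trans lI|exact: le_trans Dr].
have [m mI mb] := xb s sU.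
(* Balance and [a1 + a2 = 1] split the total rate exactly in the shares [a1] and [a2], so [r] can be
   the total rate in bits, averaged over time. *)
have R1E : R1 = a1 * (R1 + R2) by rewrite mulrDr bal -mulrDl a12 mul1r.
have R2E : R2 = a2 * (R1 + R2) by rewrite mulrDr -bal -mulrDl a12 mul1r.
have WE : (1 - s) * R1 + s * R2 = ((1 - s) * a1 + s * a2) * (R1 + R2).
  by rewrite [RHS]mulrDl -!mulrA -R1E -R2E.
have /andP[s0 s1] := sU.
have w0 : 0 <= (1 - s) * a1 + s * a2.
  by rewrite addr_ge0 ?mulr_ge0// subr_ge0.
(* This factor would vanish for [s = 0] with [a1 = 0], or [s = 1] with [a2 = 0]; positivity of the
   weighted rate excludes both, so it can be cancelled. *)
have w_gt0 : 0 < (1 - s) * a1 + s * a2.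
  rewrite lt_neqAle w0 andbT; apply/eqP => w_eq0.
  by move: W0; rewrite WE -w_eq0 mul0r ltxx.
have sup_le : sup achievable <= (R1 + R2) / (T * ln 2).
  have := le_trans mb (Wb m mI); rewrite WE /weight.
  by rewrite mulrCA ler_pM2l// ler_pdivlMr.
have p0 t : 0 <= t <= T -> [/\ 0 <= q t, 0 <= Pbar - q t & q t + (Pbar - q t) <= Pbar].
  by move=> _; have /andP[a b] := qP t; rewrite subr_ge0 addrC subrK.
have mx := speed_ok_measurable (ltW T0) (ltW V0) xV.
have mqT : measurable_fun `[0, T] q by exact: measurable_funTS.
have mlT : measurable_fun `[0, T] l by exact: measurable_funTS.
have mpT : measurable_fun `[0, T] (fun t => Pbar - q t) by exact: measurable_funB.
have [i1 i2 i12] := capacity_integrable_on g1K g2K g1_gt0 g2_gt0 g1G g2G mx mqT mpT p0.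
have [mr1 mr2] := measurable_rates Pbar g1K g2K (measurable_itv `[0, T]) mx mqT mlT.
have ir1 : integrable_on 0 T (fun t => rate1 g1 g2 Pbar (x t) (q t) (l t)).
  apply: (@bounded_integrable_on _ _ _ (Pbar * G)) => // t _.
  exact: (rate1_bound g1_gt0 g2_gt0 g1G g2G).
have ir2 : integrable_on 0 T (fun t => rate2 g1 g2 Pbar (x t) (q t) (l t)).
  apply: (@bounded_integrable_on _ _ _ (Pbar * G)) => // t _.
  exact: (rate2_bound g1_gt0 g2_gt0 g1G g2G).
have b1 t := rate1_itv g1_gt0 g2_gt0 g1G g2G (x t) (qP t) (lU t).
have b2 t := rate2_itv g1_gt0 g2_gt0 g1G g2G (x t) (qP t) (lU t).
exists ((R1 + R2) / (T * ln 2)), (R1 / (T * ln 2)), (R2 / (T * ln 2)),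
  q, (fun t => Pbar - q t); split; last first.
  move=> r r1 r2 y p1 p2 feas; apply: le_trans sup_le.
  by apply: ub_le_sup; [case: achievable_bounded|exists r1, r2, y, p1, p2].
split => //.
- by rewrite mulrA -R1E.
- by rewrite mulrA -R2E.
split.
- apply: divr_ge0; last exact: ltW.
  by apply: Rintegral_ge0 => t _; case/andP: (b1 t).
- apply: divr_ge0; last exact: ltW.
  by apply: Rintegral_ge0 => t _; case/andP: (b2 t).
- rewrite avg_log2// ler_pM2r ?invr_gt0//.
  by apply: integ_le => // t _; case/andP: (b1 t).
- rewrite avg_log2// ler_pM2r ?invr_gt0//.
  by apply: integ_le => // t _; case/andP: (b2 t).
- rewrite avg_log2// -mulrDl ler_pM2r ?invr_gt0// -integD//.
  apply: integ_le => //; first exact: integrable_onD.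
  by move=> t _; rewrite rateD.
Qed.

End optimality.

Theorem theorem2 (R : realType) (D H beta0 Pbar T V a1 a2 : R) :
  0 < D -> 0 < H -> 0 < beta0 -> 0 < Pbar -> 0 < T -> 0 < V ->
  0 <= a1 -> 0 <= a2 -> a1 + a2 = 1 ->
  exists xI xF tI tF : R,
    [/\ - (D / 2) <= xI, xI <= xF, xF <= D / 2 &
        [/\ 0 <= tI, 0 <= tF & tI + (xF - xI) / V + tF = T]] /\
    exists (r r1 r2 : R) (p1 p2 : R -> R),
      P1_optimal D H beta0 Pbar T V a1 a2 r r1 r2 (hfh T V xI xF tI tF) p1 p2.
Proof.
move=> D0 H0 beta0_gt0 P0 T0 V0 a10 a20 a12; exact: hfh_optimal.
Qed.
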